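(* Let $X$ be a path-connected space and $x_0\in X$. For any subgroup $H\subseteq\pi_1(X,x_0)$, the following are equivalent: (1) $H$ is a $\mathbf{Fan}$-covering subgroup of $\pi_1(X,x_0)$; (2) $p_H:\widetilde{X}_H^{qtop}\to X$ is a $\mathbf{Fan}$-covering; (3) $p_H:\widetilde{X}_H^{qtop}\to X$ has the unique path lifting property; (4) $(p_H)_*(\pi_1(\widetilde{X}_H^{qtop},\tilde{x}_H))=H$.
   Context: Maps are continuous functions. Let $(J,\leq)$ be a directed set and $K=J\cup\{\infty\}$ be obtained by adding one maximal point $\infty$. Give $K$ the topology generated by the basis sets $\{k\}$ and $V_k=\{\infty\}\cup\{j\in J : j>k\}$ for $k\in J$. The directed arc-fan over $J$ is the cone $F(J)=(K\times[0,1])/(K\times\{0\})$ with the quotient topology. $\mathbf{Fan}$ is the full subcategory of the category of path-connected spaces consisting of all path-connected spaces which are a quotient of a topological sum of spaces each of which is either the closed unit disk $D^2$ or a directed arc-fan $F(J)$ for some directed set $J$. A $\mathbf{Fan}$-covering is a map $p:\widehat{X}\to X$ such that $\widehat{X}\in\mathbf{Fan}$ and for every $Y\in\mathbf{Fan}$, $\tilde{x}\in\widehat{X}$, $y\in Y$ and based map $f:(Y,y)\to(X,p(\tilde{x}))$ with $f_*(\pi_1(Y,y))\subseteq p_*(\pi_1(\widehat{X},\tilde{x}))$, there is a unique map $\tilde{f}:(Y,y)\to(\widehat{X},\tilde{x})$ with $p\circ\tilde{f}=f$. A subgroup $H\subseteq\pi_1(X,x_0)$ is a $\mathbf{Fan}$-covering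 subgroup if there is a $\mathbf{Fan}$-covering $p:(\widehat{X},\hat{x})\to(X,x_0)$ with $p_*(\pi_1(\widehat{X},\hat{x}))=H$. A map $f:E\to X$ has the unique path lifting property if for any two paths $\alpha,\beta:[0,1]\to E$, $\alpha=\beta$ whenever $f\circ\alpha=f\circ\beta$ and $\alpha(0)=\beta(0)$. $P(X,x_0)$ is the space of paths $\alpha:[0,1]\to X$ with $\alpha(0)=x_0$, with the compact-open topology. $\widetilde{X}_H^{qtop}$ is the set of equivalence classes $[\alpha]_H$ of $\alpha\in P(X,x_0)$, where $\alpha\sim\beta$ iff $\alpha(1)=\beta(1)$ and $[\alpha\cdot\beta^-]\in H$ ($\beta^-$ is the reverse path), with the quotient topology with respect to $q:P(X,x_0)\to\widetilde{X}_H^{qtop}$, $q(\alpha)=[\alpha]_H$. The basepoint is $\tilde{x}_H=[c_{x_0}]_H$, the class of the constant path at $x_0$. The map $p_H:\widetilde{X}_H^{qtop}\to X$ is $p_H([\alpha]_H)=\alpha(1)$. *)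

(* Defs.v *)
From HB Require Import structures.
From mathcomp Require Import all_boot all_order all_algebra.
From mathcomp Require Import all_classical all_reals.
From mathcomp Require Import topology normedtype homotopy.
From mathcomp Require Import lra.

Set Implicit Arguments.
Unset Strict Implicit.
Unset Printing Implicit Defensive.

Import Order.TTheory GRing.Theory Num.Theory numFieldNormedType.Exports.
Local Open Scope classical_set_scope.
Local Open Scope ring_scope.
Local Open Scope quotient_scope.

Section UnitInterval.
Context {R : realType}.

Definition unit_itv : Type := `[0, 1 : R]%classic.

HB.instance Definition _ := Topological.on unit_itv.

Definition clamp01 (x : R) : R := Num.min 1 (Num.max 0 x).

Lemma clamp01_in x : clamp01 x \in `[0, 1]%classic.
Proof.
rewrite inE /= in_itv /= /clamp01 le_min ler01 le_max lexx /=.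
by rewrite ge_min lexx.
Qed.

(* The retraction of R onto [0,1]; it lets paths be reparameterized by real
   expressions without carrying membership proofs. *)
Definition clamp (x : R) : unit_itv :=
  exist (fun y : R => y \in `[0, 1]%classic) (clamp01 x) (clamp01_in x).

Definition ival (t : unit_itv) : R := \val t.

Lemma ival_itv t : 0 <= ival t <= 1.
Proof. by have := set_valP t; rewrite /= in_itv. Qed.

Lemma ival_ge0 t : 0 <= ival t.
Proof. by case/andP: (ival_itv t). Qed.

Lemma ival_le1 t : ival t <= 1.
Proof. by case/andP: (ival_itv t). Qed.

Lemma clampK x : 0 <= x <= 1 -> ival (clamp x) = x.
Proof.
move=> /andP[x0 x1]; rewrite /ival /= /clamp01 max_r //; exact: min_r.
Qed.

Lemma ivalK t : clamp (ival t) = t.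
Proof. by apply: val_inj; rewrite [LHS]clampK // ival_ge0 ival_le1. Qed.

Lemma clamp_le0 x : x <= 0 -> clamp x = clamp 0.
Proof.
by move=> x0; apply: val_inj; rewrite /= /clamp01 maxxx max_l.
Qed.

Lemma clamp_ge1 x : 1 <= x -> clamp x = clamp 1.
Proof.
move=> x1; apply: val_inj; rewrite /= /clamp01 !max_r // ?(le_trans ler01) //.
by rewrite minxx min_l.
Qed.

Lemma ival_continuous : continuous ival.
Proof. exact: initial_continuous. Qed.

Lemma continuous_unit_itv (Z : topologicalType) (f : Z -> unit_itv) :
  continuous (ival \o f) -> continuous f.
Proof. exact: continuous_comp_initial. Qed.

Lemma clamp_continuous : continuous clamp.
Proof.
apply: continuous_unit_itv.
have -> : ival \o clamp = (cst 1 \min (cst 0 \max idfun))%R :> (R -> R) by [].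
apply: min_fun_continuous; first by move=> x; exact: cvg_cst.
by apply: max_fun_continuous => x; [exact: cvg_cst|exact: cvg_id].
Qed.

Lemma clamp01_neq : clamp 0 != clamp 1.
Proof.
apply/eqP => /(congr1 ival); rewrite !clampK ?lexx ?ler01 //.
by move/eqP; rewrite eq_sym oner_eq0.
Qed.

HB.instance Definition _ := isBiPointed.Build unit_itv clamp01_neq.

Lemma ival0 : ival zero = 0.
Proof. by rewrite [LHS]clampK // lexx ler01. Qed.

Lemma ival1 : ival one = 1.
Proof. by rewrite [LHS]clampK // lexx ler01. Qed.

End UnitInterval.
Arguments unit_itv R : clear implicits.

Section Continuity.
Context {R : realType} {Z : topologicalType}.
Implicit Types u v : Z -> R.

Lemma contC (c : R) : continuous (fun _ : Z => c).
Proof. by move=> z; exact: cvg_cst. Qed.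

Lemma contD u v : continuous u -> continuous v ->
  continuous (fun z => u z + v z).
Proof. by move=> cu cv z; apply: cvgD; [exact: cu|exact: cv]. Qed.

Lemma contB u v : continuous u -> continuous v ->
  continuous (fun z => u z - v z).
Proof. by move=> cu cv z; apply: cvgB; [exact: cu|exact: cv]. Qed.

Lemma contM u v : continuous u -> continuous v ->
  continuous (fun z => u z * v z).
Proof. by move=> cu cv z; apply: cvgM; [exact: cu|exact: cv]. Qed.

Lemma cont_clamp u : continuous u -> continuous (fun z => clamp (u z)).
Proof.
move=> cu z; apply: (@continuous_comp _ _ _ u clamp); first exact: cu.
exact: clamp_continuous.
Qed.

Lemma cont_ival (f : Z -> unit_itv R) :
  continuous f -> continuous (fun z => ival (f z)).
Proof.
move=> cf z; apply: (@continuous_comp _ _ _ f ival); first exact: cf.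
exact: ival_continuous.
Qed.

Lemma cont_comp (X Y : topologicalType) (f : Z -> X) (g : X -> Y) :
  continuous f -> continuous g -> continuous (fun z => g (f z)).
Proof.
by move=> cf cg z; apply: (@continuous_comp _ _ _ f g); [exact: cf|exact: cg].
Qed.

Lemma cont_pair (X Y : topologicalType) (f : Z -> X) (g : Z -> Y) :
  continuous f -> continuous g -> continuous (fun z => (f z, g z)).
Proof. by move=> cf cg z; apply: cvg_pair; [exact: cf|exact: cg]. Qed.

End Continuity.

Lemma cont_fst (X Y : topologicalType) : continuous (fst : X * Y -> X).
Proof. by case=> x y; exact: cvg_fst. Qed.

Lemma cont_snd (X Y : topologicalType) : continuous (snd : X * Y -> Y).
Proof. by case=> x y; exact: cvg_snd. Qed.

Lemma cont_id (X : topologicalType) : continuous (fun x : X => x).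
Proof. by move=> x; exact: cvg_id. Qed.

Ltac cont := repeat first [ exact: contC | exact: cont_id | exact: cts_fun
  | exact: cont_fst | exact: cont_snd | exact: ival_continuous
  | apply: cont_clamp | apply: contM | apply: contB | apply: contD
  | apply: cont_ival | apply: cont_pair ].

Section Pasting.
Context {R : realType} {Z X : topologicalType}.

Lemma continuous_paste (u : Z -> R) (f g : Z -> X) :
  continuous u -> continuous f -> continuous g ->
  (forall z, u z = 2^-1 -> f z = g z) ->
  continuous (fun z => if u z <= 2^-1 then f z else g z).
Proof.
move=> cu cf cg fg; apply/continuous_subspace_setT.
have -> : [set: Z] = u @^-1` [set x | x <= 2^-1] `|` u @^-1` [set x | 2^-1 <= x].
  rewrite eqEsubset; split => // z _ /=.
  by case: (lerP (u z) 2^-1) => [|/ltW]; [left|right].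
apply: withinU_continuous.
- by apply: closed_comp; [move=> z _; exact: cu|exact: closed_le].
- by apply: closed_comp; [move=> z _; exact: cu|exact: closed_ge].
- apply: (@subspace_eq_continuous _ _ _ f); last exact: continuous_subspaceT.
  by move=> z; rewrite inE /= => uz; rewrite /from_subspace uz.
- apply: (@subspace_eq_continuous _ _ _ g); last exact: continuous_subspaceT.
  move=> z; rewrite inE /= => uz; rewrite /from_subspace; case: ifP => // uz'; apply/esym/fg.
  by apply/eqP; rewrite eq_le uz uz'.
Qed.

End Pasting.

Section Paths.
Context {R : realType} {X : topologicalType}.
Local Notation I := (unit_itv R).

(* The empty space is path-connected under this convention. *)
Definition path_connected :=
  forall x y : X, inhabited {path I from x to y}.

Section PathOps.
Context {x y z : X}.

Definition path_concat (a : {path I from x to y}) (b : {path I from y to z})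
    (t : I) : X :=
  if ival t <= 2^-1 then a (clamp (2 * ival t))
  else b (clamp (2 * ival t - 1)).

Definition path_rev (a : {path I from x to y}) (t : I) : X :=
  a (clamp (1 - ival t)).

End PathOps.

Section PathOpsTheory.
Context {x y z : X} (a : {path I from x to y}) (b : {path I from y to z}).

Lemma path_concat_continuous : continuous (path_concat a b).
Proof.
apply: continuous_paste.
- exact: ival_continuous.
- by apply: cont_comp; last exact: cts_fun; cont.
- by apply: cont_comp; last exact: cts_fun; cont.
- move=> t ->; rewrite mulfV ?pnatr_eq0 // subrr.
  by rewrite -[clamp 1]/(one : I) -[clamp 0]/(zero : I) path_one path_zero.
Qed.

Lemma path_concat_zero : path_concat a b zero = x.
Proof.
by rewrite /path_concat ival0 invr_ge0 ler0n mulr0 path_zero.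
Qed.

Lemma path_concat_one : path_concat a b one = z.
Proof.
rewrite /path_concat ival1 mulr1 ifF; last by apply/negbTE; rewrite -ltNge; lra.
by rewrite (_ : 2 - 1 = 1 :> R) ?path_one //; lra.
Qed.

HB.instance Definition _ :=
  isContinuous.Build I X (path_concat a b) path_concat_continuous.
HB.instance Definition _ :=
  isPath.Build I X x z (path_concat a b) path_concat_zero path_concat_one.

Lemma path_rev_continuous : continuous (path_rev a).
Proof.
by apply: cont_comp; last exact: cts_fun; cont.
Qed.

Lemma path_rev_zero : path_rev a zero = y.
Proof. by rewrite /path_rev ival0 subr0 path_one. Qed.

Lemma path_rev_one : path_rev a one = x.
Proof. by rewrite /path_rev ival1 subrr path_zero. Qed.

HB.instance Definition _ :=
  isContinuous.Build I X (path_rev a) path_rev_continuous.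
HB.instance Definition _ :=
  isPath.Build I X y x (path_rev a) path_rev_zero path_rev_one.

End PathOpsTheory.

(* Homotopy relative to the endpoints: H (s, t) is at position s at time t. *)
Definition path_homotopic {x y : X} (a b : {path I from x to y}) : Prop :=
  exists H : (I * I)%type -> X,
    [/\ continuous H,
        forall s, H (s, zero) = a s,
        forall s, H (s, one) = b s &
        forall t, H (zero, t) = x /\ H (one, t) = y].

Lemma path_homotopic_refl x y (a : {path I from x to y}) : path_homotopic a a.
Proof.
exists (fun z => a z.1); split => //; last by move=> t; rewrite path_zero path_one.
by apply: cont_comp; last exact: cts_fun; cont.
Qed.

Lemma path_homotopic_sym x y (a b : {path I from x to y}) :
  path_homotopic a b -> path_homotopic b a.
Proof.
move=> [H [cH Ha Hb He]]; exists (fun z => H (z.1, clamp (1 - ival z.2))).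
split=> [|s|s|t] /=; last exact: He.
- apply: cont_comp; last exact: cH.
  by cont; apply: (cont_comp (f := snd) (g := ival)); cont.
- by rewrite ival0 subr0 -[clamp 1]/one Hb.
- by rewrite ival1 subrr -[clamp 0]/zero Ha.
Qed.

Lemma path_homotopic_trans x y (a b c : {path I from x to y}) :
  path_homotopic a b -> path_homotopic b c -> path_homotopic a c.
Proof.
move=> [H [cH Ha Hb He]] [K [cK Kb Kc Ke]].
exists (fun z => if ival z.2 <= 2^-1 then H (z.1, clamp (2 * ival z.2))
                 else K (z.1, clamp (2 * ival z.2 - 1))); split.
- apply: (continuous_paste (u := fun z : (I * I)%type => ival z.2)).
  + by cont.
  + by apply: cont_comp; last exact: cH; cont.
  + by apply: cont_comp; last exact: cK; cont.
  + move=> z ->; rewrite mulfV ?pnatr_eq0 // subrr.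
    by rewrite -[clamp 1]/(one : I) -[clamp 0]/(zero : I) Hb Kb.
- by move=> s; rewrite /= ival0 invr_ge0 ler0n mulr0 Ha.
- move=> s; rewrite /= ival1 mulr1 ifF; last by apply/negbTE; rewrite -ltNge; lra.
  by rewrite (_ : 2 - 1 = 1 :> R) ?Kc //; lra.
- by move=> t /=; case: ifP => _; [exact: He|exact: Ke].
Qed.

Lemma path_homotopic_eq x y (a b : {path I from x to y}) :
  a =1 b -> path_homotopic a b.
Proof. by move=> /path_eqP ->; exact: path_homotopic_refl. Qed.

Lemma path_homotopic_reparam x y (a : {path I from x to y}) (f g : I -> I)
    (b c : {path I from x to y}) :
  continuous f -> continuous g -> f zero = g zero -> f one = g one ->
  (forall s, b s = a (f s)) -> (forall s, c s = a (g s)) ->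
  path_homotopic b c.
Proof.
move=> cf cg fg0 fg1 bE cE.
exists (fun z => a (clamp ((1 - ival z.2) * ival (f z.1) +
                           ival z.2 * ival (g z.1)))); split.
- apply: cont_comp; last exact: cts_fun.
  cont; by apply: cont_comp; last by []; cont.
- by move=> s; rewrite /= ival0 subr0 mul1r mul0r addr0 ivalK bE.
- by move=> s; rewrite /= ival1 subrr mul1r mul0r add0r ivalK cE.
- move=> t /=; rewrite -fg0 -fg1 -!mulrDl subrK !mul1r !ivalK -!bE.
  by rewrite path_zero path_one.
Qed.

Lemma path_homotopic_concat x y z (a a' : {path I from x to y})
    (b b' : {path I from y to z}) :
  path_homotopic a a' -> path_homotopic b b' ->
  path_homotopic (path_concat a b) (path_concat a' b').
Proof.
move=> [H [cH Ha Ha' He]] [K [cK Kb Kb' Ke]].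
exists (fun z => if ival z.1 <= 2^-1 then H (clamp (2 * ival z.1), z.2)
                 else K (clamp (2 * ival z.1 - 1), z.2)); split.
- apply: (continuous_paste (u := fun z : (I * I)%type => ival z.1)).
  + by cont.
  + by apply: cont_comp; last exact: cH; cont.
  + by apply: cont_comp; last exact: cK; cont.
  + move=> u ->; rewrite mulfV ?pnatr_eq0 // subrr.
    by rewrite -[clamp 1]/(one : I) -[clamp 0]/(zero : I) (He _).2 (Ke _).1.
- by move=> s; rewrite /= /path_concat Ha Kb.
- by move=> s; rewrite /= /path_concat Ha' Kb'.
- move=> t /=; rewrite ival0 ival1 invr_ge0 ler0n mulr0 (He _).1.
  rewrite mulr1 ifF; last by apply/negbTE; rewrite -ltNge; lra.
  by rewrite (_ : 2 - 1 = 1 :> R) ?(Ke _).2 //; lra.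
Qed.

Lemma path_homotopic_rev x y (a b : {path I from x to y}) :
  path_homotopic a b -> path_homotopic (path_rev a) (path_rev b).
Proof.
move=> [H [cH Ha Hb He]]; exists (fun z => H (clamp (1 - ival z.1), z.2)).
split=> [|s|s|t] /=.
- by apply: cont_comp; last exact: cH; cont.
- by rewrite Ha.
- by rewrite Hb.
- by rewrite ival0 ival1 subr0 subrr (He _).1 (He _).2.
Qed.

Lemma path_concatA x y z w (a : {path I from x to y}) (b : {path I from y to z})
    (c : {path I from z to w}) :
  path_homotopic (path_concat a (path_concat b c))
                 (path_concat (path_concat a b) c).
Proof.
pose abc := path_concat a (path_concat b c).
pose m (t : R) := Num.min (2 * t) (Num.min (t + 4^-1) ((1 + t) / 2)).
have cm : continuous (fun t : I => clamp (m (ival t))).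
  apply: cont_clamp; apply: min_fun_continuous; first by cont.
  by apply: min_fun_continuous; cont.
apply: path_homotopic_sym.
apply: (path_homotopic_reparam (a := abc) (f := fun t => clamp (m (ival t)))
          (g := fun t => t)) => //; first exact: cont_id.
- rewrite ival0 /m; congr clamp; rewrite /Num.min; do 2?case: ifP; lra.
- rewrite ival1 /m; congr clamp; rewrite /Num.min; do 2?case: ifP; lra.
move=> s; have /andP[s0 s1] := ival_itv s; set t := ival s in s0 s1 *.
have mE : ival (clamp (m t)) = m t.
  apply: clampK; rewrite /m /Num.min; do 2?case: ifP; lra.
rewrite /abc /= /path_concat /= /path_concat mE -/t.
have [t2|t2] := lerP t 2^-1.
  rewrite (clampK (x := 2 * t)); last lra.
  have [t4|t4] := lerP (2 * t) 2^-1.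
    have -> : m t = 2 * t by rewrite /m /Num.min; do 2?case: ifP; lra.
    by rewrite t4.
  have -> : m t = t + 4^-1 by rewrite /m /Num.min; do 2?case: ifP; lra.
  rewrite ifF; last by apply/negbTE; rewrite -ltNge; lra.
  rewrite clampK; last lra.
  by rewrite ifT; [congr (b (clamp _)); lra|lra].
have -> : m t = (1 + t) / 2 by rewrite /m /Num.min; do 2?case: ifP; lra.
rewrite ifF; last by apply/negbTE; rewrite -ltNge; lra.
rewrite clampK; last lra.
rewrite ifF; last by apply/negbTE; rewrite -ltNge; lra.
by congr (c (clamp _)); lra.
Qed.

Lemma path_concat_cstl x y (a : {path I from x to y}) :
  path_homotopic (path_concat (cst x) a) a.
Proof.
apply: (path_homotopic_reparam (a := a) (f := fun t => clamp (2 * ival t - 1))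
          (g := fun t => t)) => //; try by cont.
- by rewrite ival0 mulr0 sub0r clamp_le0 // oppr_le0.
- by rewrite ival1 mulr1 (_ : 2 - 1 = 1 :> R) //; lra.
move=> s; rewrite /= /path_concat; case: ifP => // s2.
change (x = a (clamp (2 * ival s - 1))).
by rewrite clamp_le0; [rewrite -[clamp 0]/zero path_zero|lra].
Qed.

Lemma path_concat_cstr x y (a : {path I from x to y}) :
  path_homotopic (path_concat a (cst y)) a.
Proof.
apply: (path_homotopic_reparam (a := a) (f := fun t => clamp (2 * ival t))
          (g := fun t => t)) => //; try by cont.
- by rewrite ival0 mulr0.
- by rewrite ival1 mulr1 clamp_ge1 //; lra.
move=> s; rewrite /= /path_concat; case: (lerP (ival s) 2^-1) => // s2.
change (y = a (clamp (2 * ival s))).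
by rewrite clamp_ge1; [rewrite -[clamp 1]/one path_one|lra].
Qed.

Lemma path_concat_revr x y (a : {path I from x to y}) :
  path_homotopic (path_concat a (path_rev a)) (cst x).
Proof.
pose m (t : R) := Num.min (2 * t) (2 - 2 * t).
pose H (z : I * I) := a (clamp ((1 - ival z.2) * m (ival z.1))).
exists H; split.
- apply: cont_comp; last exact: cts_fun.
  apply: cont_clamp; apply: contM; first by cont.
  by apply: min_fun_continuous; cont.
- move=> s; have /andP[s0 s1] := ival_itv s.
  rewrite /H /m /= ival0 subr0 mul1r /path_concat /path_rev.
  have [s2|s2] := lerP (ival s) 2^-1.
    by congr (a (clamp _)); rewrite /Num.min; case: ifP; lra.
  rewrite /= /path_rev clampK; last lra.
  by congr (a (clamp _)); rewrite /Num.min; case: ifP; lra.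
- by move=> s; rewrite /H /= ival1 subrr mul0r -[clamp 0]/zero path_zero.
- move=> t; rewrite /H /m /= ival0 ival1 mulr0 mulr1 subrr subr0.
  rewrite [Num.min 0 _]min_l ?ler0n // [Num.min 2 _]min_r ?ler0n //.
  by rewrite !mulr0 -[clamp 0]/zero path_zero.
Qed.

Lemma path_revK x y (a : {path I from x to y}) : path_rev (path_rev a) =1 a.
Proof.
move=> t; rewrite /path_rev /=; have := ival_itv t => t01.
by rewrite /path_rev clampK ?subKr ?ivalK //; lra.
Qed.

Lemma path_concat_revl x y (a : {path I from x to y}) :
  path_homotopic (path_concat (path_rev a) a) (cst y).
Proof.
apply: (path_homotopic_trans _ (path_concat_revr (path_rev a))).
apply: path_homotopic_concat; first exact: path_homotopic_refl.
by apply: path_homotopic_eq => t; exact/esym/path_revK.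
Qed.

Lemma path_rev_concat x y z (a : {path I from x to y}) (b : {path I from y to z}) :
  path_rev (path_concat a b) =1 path_concat (path_rev b) (path_rev a).
Proof.
move=> s; have /andP[s0 s1] := ival_itv s.
rewrite {1}/path_rev /= {1}/path_concat clampK; last lra.
rewrite /path_concat /= /path_rev.
have [s2|s2] := ltrP (ival s) 2^-1.
  rewrite ifF; last by apply/negbTE; rewrite -ltNge; lra.
  rewrite ifT; last lra.
  by rewrite clampK; [congr (b (clamp _)); lra|lra].
rewrite ifT; last lra.
case: ifP => s3; last first.
  by rewrite clampK; [congr (a (clamp _)); lra|lra].
have -> : ival s = 2^-1 by lra.
rewrite (_ : 2 * (1 - 2^-1) = 1 :> R); last lra.
rewrite (_ : 2 * 2^-1 = 1 :> R); last lra.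
by rewrite clampK ?lexx ?ler01 // subrr -[clamp 1]/one -[clamp 0]/zero
           path_zero path_one.
Qed.

End Paths.
Arguments path_connected R X : clear implicits.

Section FundamentalGroup.
Context {R : realType} {X : topologicalType}.
Local Notation I := (unit_itv R).

Section Pi1.
Context {x : X}.
Local Notation loop := {path I from x to x}.

Definition loop_equiv : rel loop := fun a b => `[< path_homotopic a b >].

Lemma loop_equiv_refl : reflexive loop_equiv.
Proof. by move=> a; apply/asboolP; exact: path_homotopic_refl. Qed.

Lemma loop_equiv_sym : symmetric loop_equiv.
Proof.
by move=> a b; apply/asboolP/asboolP; exact: path_homotopic_sym.
Qed.

Lemma loop_equiv_trans : transitive loop_equiv.
Proof.
move=> b a c /asboolP ab /asboolP bc; apply/asboolP.
exact: path_homotopic_trans ab bc.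
Qed.

Canonical loop_equiv_equiv :=
  EquivRel loop_equiv loop_equiv_refl loop_equiv_sym loop_equiv_trans.

Definition pi1 : Type := {eq_quot loop_equiv}.

HB.instance Definition _ := Choice.on pi1.
HB.instance Definition _ := Quotient.on pi1.

Lemma pi1P (a b : loop) : path_homotopic a b <-> \pi_pi1 a = \pi_pi1 b.
Proof.
split; first by move=> ab; apply/eqmodP/asboolP.
by move=> /eqmodP /asboolP.
Qed.

Lemma pi1_repr (a : loop) : path_homotopic (repr (\pi_pi1 a)) a.
Proof. by apply/pi1P; rewrite reprK. Qed.

Definition pi1_one : pi1 := \pi_pi1 (cst x : loop).
Definition pi1_mul (u v : pi1) : pi1 := \pi_pi1 (path_concat (repr u) (repr v)).
Definition pi1_inv (u : pi1) : pi1 := \pi_pi1 (path_rev (repr u)).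

Lemma pi1_mulE (a b : loop) :
  pi1_mul (\pi_pi1 a) (\pi_pi1 b) = \pi_pi1 (path_concat a b).
Proof. by apply/pi1P/path_homotopic_concat; exact: pi1_repr. Qed.

Lemma pi1_invE (a : loop) : pi1_inv (\pi_pi1 a) = \pi_pi1 (path_rev a).
Proof. by apply/pi1P/path_homotopic_rev; exact: pi1_repr. Qed.

Lemma pi1_mulA : associative pi1_mul.
Proof.
move=> u v w; elim/quotW: u => a; elim/quotW: v => b; elim/quotW: w => c.
rewrite (pi1_mulE b c) (pi1_mulE a b) !pi1_mulE.
by apply/pi1P; exact: path_concatA.
Qed.

Lemma pi1_mul1 : left_id pi1_one pi1_mul.
Proof.
elim/quotW => a; rewrite pi1_mulE.
by apply/pi1P; exact: path_concat_cstl.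
Qed.

Lemma pi1_mulr1 : right_id pi1_one pi1_mul.
Proof.
elim/quotW => a; rewrite pi1_mulE.
by apply/pi1P; exact: path_concat_cstr.
Qed.

Lemma pi1_mulV : left_inverse pi1_one pi1_inv pi1_mul.
Proof.
elim/quotW => a; rewrite pi1_invE pi1_mulE.
by apply/pi1P; exact: path_concat_revl.
Qed.

Lemma pi1_mulrV : right_inverse pi1_one pi1_inv pi1_mul.
Proof.
elim/quotW => a; rewrite pi1_invE pi1_mulE.
by apply/pi1P; exact: path_concat_revr.
Qed.

HB.instance Definition _ := isGroup.Build pi1
  pi1_mulA pi1_mul1 pi1_mulr1 pi1_mulV pi1_mulrV.

End Pi1.
End FundamentalGroup.
Arguments pi1 R {X} x.

Section InducedMap.
Context {R : realType} {X Y : topologicalType}.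
Local Notation I := (unit_itv R).

Section PushPath.
Context {x : X} {y : Y} (f : continuousType X Y) (fx : f x = y).

Definition push_loop (a : {path I from x to x}) : I -> Y :=
  let _ := fx in f \o a.

Section Instances.
Context (a : {path I from x to x}).

Lemma push_loop_continuous : continuous (push_loop a).
Proof. by apply: cont_comp; exact: cts_fun. Qed.

Lemma push_loop_zero : push_loop a zero = y.
Proof. by rewrite /push_loop /= path_zero. Qed.

Lemma push_loop_one : push_loop a one = y.
Proof. by rewrite /push_loop /= path_one. Qed.

HB.instance Definition _ :=
  isContinuous.Build I Y (push_loop a) push_loop_continuous.
HB.instance Definition _ :=
  isPath.Build I Y y y (push_loop a) push_loop_zero push_loop_one.

End Instances.

(* Independent of the representative chosen by repr, see pi1_mapE. *)
Definition pi1_map (u : pi1 R x) : pi1 R y := \pi_(pi1 R y) (push_loop (repr u)).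

Lemma pi1_mapE (a : {path I from x to x}) :
  pi1_map (\pi_(pi1 R x) a) = \pi_(pi1 R y) (push_loop a).
Proof.
apply/pi1P; have [H [cH H0 H1 He]] := pi1_repr a.
exists (f \o H); split => [|s|s|t] /=.
- by apply: cont_comp; [exact: cH|exact: cts_fun].
- by rewrite H0.
- by rewrite H1.
- by rewrite !(He t).1 !(He t).2.
Qed.

End PushPath.
End InducedMap.

Arguments pi1_map R {X Y x y f} fx u.

(* A directed set is a nonempty preorder in which any two elements have an upper
   bound. Nonemptiness is needed for the sets infty_nbhd to cover None. *)
HB.mixin Record isDirected (d : Order.disp_t) J & Order.Preorder d J := {
  directed_inhabited : inhabited J;
  directed_ub : forall i j : J, exists k : J, (i <= k)%O /\ (j <= k)%O
}.

#[short(type="directedType")]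
HB.structure Definition Directed (d : Order.disp_t) :=
  { J of Order.Preorder d J & isDirected d J }.

(* None plays the role of the point at infinity. *)
Definition adjoin_infty (J : Type) : Type := option J.

Section AdjoinInfty.
Context {d : Order.disp_t} {J : directedType d}.
Local Notation K := (adjoin_infty J).

HB.instance Definition _ := Choice.on K.

(* In a preorder, k < j means that k <= j holds and j <= k does not; for a partial
   order this is k <= j and k <> j. *)
Definition infty_nbhd (k : J) : set K :=
  [set None] `|` Some @` [set j | (k < j)%O].

Definition adjoin_infty_basis : set (set K) :=
  [set U | (exists k : J, U = [set Some k]) \/ (exists k : J, U = infty_nbhd k)].

Lemma adjoin_infty_cover : \bigcup_(U in adjoin_infty_basis) U = setT.
Proof.
rewrite eqEsubset; split => // -[j|] _; first by exists [set Some j]; [left; exists j|].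
have [k] := @directed_inhabited d J.
by exists (infty_nbhd k); [right; exists k|left].
Qed.

Lemma adjoin_infty_join (U V : set K) (t : K) :
  adjoin_infty_basis U -> adjoin_infty_basis V -> U t -> V t ->
  exists W, [/\ adjoin_infty_basis W, W t & W `<=` U `&` V].
Proof.
case: t => [j|] bU bV Ut Vt.
  by exists [set Some j]; split => //; [left; exists j|move=> _ ->].
case: bU Ut => -[k -> //] _; case: bV Vt => -[l -> //] _.
have [m [km lm]] := directed_ub k l.
exists (infty_nbhd m); split; [by right; exists m|by left|].
move=> _ [->|[j /= mj <-]]; first by split; left.
by split; right; exists j => //=; [exact: le_lt_trans km mj|exact: le_lt_trans lm mj].
Qed.

HB.instance Definition _ := isBaseTopological.Build K
  (b := id) adjoin_infty_cover adjoin_infty_join.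

End AdjoinInfty.

Section ArcFan.
Context {R : realType} {d : Order.disp_t} {J : directedType d}.
Local Notation cylinder := (adjoin_infty J * unit_itv R)%type.

Definition cone_equiv : rel cylinder :=
  fun u v => (u == v) || (u.2 == zero) && (v.2 == zero).

Lemma cone_equiv_refl : reflexive cone_equiv.
Proof. by move=> u; rewrite /cone_equiv eqxx. Qed.

Lemma cone_equiv_sym : symmetric cone_equiv.
Proof. by move=> u v; rewrite /cone_equiv eq_sym andbC. Qed.

Lemma cone_equiv_trans : transitive cone_equiv.
Proof.
move=> v u w /orP[/eqP -> //|/andP[u0 v0]] /orP[/eqP <-|/andP[_ w0]].
  by rewrite /cone_equiv u0 v0 orbT.
by rewrite /cone_equiv u0 w0 orbT.
Qed.

Canonical cone_equiv_equiv :=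
  EquivRel cone_equiv cone_equiv_refl cone_equiv_sym cone_equiv_trans.

(* The cone on J with a point at infinity: level zero is collapsed to a point. *)
Definition arc_fan : Type := quotient_topology {eq_quot cone_equiv}.

HB.instance Definition _ := Topological.on arc_fan.
HB.instance Definition _ := Quotient.on arc_fan.

End ArcFan.
Arguments arc_fan R {d} J.

Definition unit_disk (R : realType) : Type :=
  [set z : R * R | z.1 ^+ 2 + z.2 ^+ 2 <= 1].

HB.instance Definition _ (R : realType) := Topological.on (unit_disk R).

Inductive fan_piece : Type :=
  | Disk
  | ArcFan (d : Order.disp_t) (J : directedType d).

Definition fan_piece_space (R : realType) (P : fan_piece) : topologicalType :=
  match P with
  | Disk => unit_disk R
  | ArcFan _ J => arc_fan R J
  end.

Definition quotient_map (S X : topologicalType) (q : S -> X) : Prop :=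
  (forall x, exists s, q s = x) /\
  (forall U : set X, open U <-> open (q @^-1` U)).

Definition in_Fan (R : realType) (X : topologicalType) : Prop :=
  path_connected R X /\
  exists (A : choiceType) (P : A -> fan_piece)
         (q : {a : A & fan_piece_space R (P a)} -> X), quotient_map q.

Definition Fan_covering (R : realType) (E X : topologicalType)
    (p : continuousType E X) : Prop :=
  in_Fan R E /\
  forall (Y : topologicalType) (e : E) (y : Y) (f : continuousType Y X)
    (fy : f y = p e),
    in_Fan R Y ->
    range (pi1_map R fy) `<=` range (pi1_map R (erefl (p e))) ->
    exists! g : continuousType Y E, g y = e /\ p \o g = f :> (Y -> X).

Definition Fan_covering_subgroup (R : realType) (X : topologicalType) (x0 : X)
    (H : groupClosed (pi1 R x0)) : Prop :=
  exists (E : topologicalType) (p : continuousType E X) (e : E) (pe : p e = x0),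
    Fan_covering R p /\ range (pi1_map R pe) = [set` H].

Definition unique_path_lifting (R : realType) (E X : topologicalType)
    (f : E -> X) : Prop :=
  forall a b : continuousType (unit_itv R) E,
    f \o a = f \o b -> a zero = b zero -> a = b.

Section PathQuotient.
Context {R : realType} {X : topologicalType} {x0 : X}.
Local Notation I := (unit_itv R).

(* Subspace of the compact-open topology on all functions I -> X. *)
Definition path_space : Type :=
  [set a : {compact-open, I -> X} | continuous (a : I -> X) /\ a zero = x0].

HB.instance Definition _ := Topological.on path_space.

Definition path_fun (a : path_space) : I -> X := \val a.

Lemma path_funP (a : path_space) : continuous (path_fun a) /\ path_fun a zero = x0.
Proof. exact: (set_valP a). Qed.

Lemma path_space_of_in y (a : {path I from x0 to y}) :
  (a : {compact-open, I -> X}) \in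
    [set a : {compact-open, I -> X} | continuous (a : I -> X) /\ a zero = x0].
Proof. by rewrite inE /=; split; [exact: cts_fun|exact: path_zero]. Qed.

Definition path_space_of y (a : {path I from x0 to y}) : path_space :=
  exist (fun a : {compact-open, I -> X} => a \in _) _ (path_space_of_in a).

Lemma path_fun_path (a : path_space) :
  exists b : {path I from x0 to path_fun a one}, path_fun a = b.
Proof.
have [ca a0] := path_funP a.
by exists (mk_path ca a0 erefl).
Qed.

Section Subgroup.
Context (H : groupClosed (pi1 R x0)).

(* The underlying functions are retyped as paths ending at a common point y, so
   that a' followed by the reverse of b' is a loop at x0. *)
Definition path_equiv : rel path_space := fun a b =>
  `[< exists (y : X) (a' b' : {path I from x0 to y}),
        [/\ path_fun a = a', path_fun b = b' &
            \pi_(pi1 R x0) (path_concat a' (path_rev b')) \in H] >].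

Lemma path_equiv_refl : reflexive path_equiv.
Proof.
move=> a; apply/asboolP; have [b ab] := path_fun_path a.
exists (path_fun a one), b, b; split => //.
have -> : \pi_(pi1 R x0) (path_concat b (path_rev b)) = 1%g.
  by apply/pi1P; exact: path_concat_revr.
exact: gpred1.
Qed.

Lemma path_equiv_sym : symmetric path_equiv.
Proof.
suff sym a b : path_equiv a b -> path_equiv b a.
  by move=> a b; apply/idP/idP; exact: sym.
move=> /asboolP[y [a' [b' [aE bE Hab]]]]; apply/asboolP.
exists y, b', a'; split => //.
have -> : \pi_(pi1 R x0) (path_concat b' (path_rev a')) =
          (\pi_(pi1 R x0) (path_concat a' (path_rev b')))^-1%g.
  rewrite [RHS]pi1_invE; apply/pi1P/path_homotopic_eq => t.
  apply: (etrans _ (esym (path_rev_concat a' (path_rev b') t))).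
  congr (path_concat _ _ _).
  by apply/path_eqP => s; exact/esym/path_revK.
by rewrite gpredV.
Qed.

Lemma path_equiv_trans : transitive path_equiv.
Proof.
move=> b a c /asboolP[y [a' [b' [aE bE Hab]]]].
move=> /asboolP[z [b'' [c' [bE' cE Hbc]]]]; apply/asboolP.
have yz : y = z by rewrite -[y](path_one (s := b')) -[z](path_one (s := b'')) -bE -bE'.
subst z; have bb : b'' = b' by apply/path_eqP => t; rewrite -bE -bE'.
subst b''; exists y, a', c'; split => //.
have -> : \pi_(pi1 R x0) (path_concat a' (path_rev c')) =
    (\pi_(pi1 R x0) (path_concat a' (path_rev b')) *
     \pi_(pi1 R x0) (path_concat b' (path_rev c')))%g.
  rewrite [RHS]pi1_mulE; apply/pi1P/path_homotopic_sym.
  apply: (path_homotopic_trans (path_homotopic_sym (path_concatA _ _ _))).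
  apply: path_homotopic_concat; first exact: path_homotopic_refl.
  apply: (path_homotopic_trans (path_concatA _ _ _)).
  apply: (path_homotopic_trans _ (path_concat_cstl _)).
  apply: path_homotopic_concat; last exact: path_homotopic_refl.
  exact: path_concat_revl.
exact: gpredM.
Qed.

Canonical path_equiv_equiv :=
  EquivRel path_equiv path_equiv_refl path_equiv_sym path_equiv_trans.

Definition Xtilde : Type := quotient_topology {eq_quot path_equiv}.

HB.instance Definition _ := Topological.on Xtilde.
HB.instance Definition _ := Quotient.on Xtilde.

Definition Xtilde_base : Xtilde := \pi_Xtilde (path_space_of (cst x0)).

(* The endpoint of any path in the class u, see pHE. *)
Definition pH (u : Xtilde) : X := path_fun (repr u) one.

Lemma pHE (a : path_space) : pH (\pi_Xtilde a) = path_fun a one.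
Proof.
have /eqmodP/asboolP[y [a' [b' [aE bE _]]]] : repr (\pi_Xtilde a) = a %[mod Xtilde].
  exact: reprK.
by rewrite /pH aE bE !path_one.
Qed.

Lemma pH_continuous : continuous pH.
Proof.
apply/(@quotient_continuous _ {eq_quot path_equiv} X pH).
have -> : pH \o \pi_{eq_quot path_equiv} = (fun a => path_fun a one).
  by apply/funext => a; exact: pHE.
apply/continuousP => U oU.
have := @compact_open_open I X [set one] U (@compact_set1 I one) oU.
move=> oS; exists [set g | g @` [set one] `<=` U] => //.
rewrite eqEsubset; split => a /=; first by apply; exists one.
by move=> Ua _ [_ -> <-].
Qed.

HB.instance Definition _ := isContinuous.Build Xtilde X pH pH_continuous.

Lemma pH_base : pH Xtilde_base = x0.
Proof. by rewrite pHE. Qed.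

End Subgroup.
End PathQuotient.
Arguments Xtilde {R X x0} H.
Arguments Xtilde_base {R X x0} H.
Arguments pH {R X x0} H.
Arguments pH_base {R X x0} H.

(* Main.v *)
(* Idea. The standard lift of a path a is the path t |-> [a restricted to [0,t]]
   in Xtilde H. If paths lift uniquely, every loop of Xtilde H is a standard lift,
   whence (3) => (4). If the loops of Xtilde H project into H, closing a path c that
   starts at the base point with the reverse of a standard lift gives
   c(1) = [pH o c]; so paths lift uniquely, and a map f on a space in Fan lifts to
   y |-> [d . f(eta_y)] for any choice of paths eta_y. For (1) => (3), a Fan-covering
   p with image H yields an injective map Xtilde H -> E over X, sending [a] to the
   end of its p-lift. It is well defined because p lifts homotopies, and
   continuous because a convergent net of paths spans a map from a directed
   arc-fan, which lifts. *)
Require Import Defs.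
From HB Require Import structures.
From mathcomp Require Import all_boot all_order all_algebra.
From mathcomp Require Import all_classical all_reals.
From mathcomp Require Import topology normedtype homotopy.
From mathcomp Require Import lra.

Set Implicit Arguments.
Unset Strict Implicit.
Unset Printing Implicit Defensive.

Import Order.TTheory GRing.Theory Num.Theory numFieldNormedType.Exports.
Local Open Scope classical_set_scope.
Local Open Scope ring_scope.
Local Open Scope quotient_scope.

Section UnitIntervalTopology.
Context {R : realType}.
Local Notation I := (unit_itv R).

Lemma unit_itv_compact : compact [set: I].
Proof.
have -> : [set: I] = clamp @` `[0, 1].
  rewrite eqEsubset; split => // t _; exists (ival t); last exact: ivalK.
  by rewrite /= in_itv /=; exact: ival_itv.
apply: continuous_compact; last exact: segment_compact.
exact/continuous_subspaceT/clamp_continuous.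
Qed.

Lemma unit_itv_hausdorff : hausdorff_space I.
Proof.
move=> x y xy; rewrite -[x]ivalK -[y]ivalK; congr clamp.
apply: (@Rhausdorff R) => A B Ax By.
have [t [At Bt]] := xy _ _ (ival_continuous Ax) (ival_continuous By).
by exists (ival t).
Qed.

Lemma unit_itv_locally_compact : locally_compact [set: I].
Proof.
move=> x _; rewrite withinET; exists setT; first exact: filterT.
by split=> //; exact: unit_itv_compact.
Qed.

Lemma unit_itv_regular : regular_space I.
Proof.
by move=> x; apply: (compact_regular unit_itv_hausdorff unit_itv_compact filterT).
Qed.

End UnitIntervalTopology.

Section PathSpaceTopology.
Context {R : realType} {X : topologicalType} {x0 : X}.
Local Notation I := (unit_itv R).
Local Notation PS := (@path_space R X x0).

Lemma path_space_eqP (a b : PS) : path_fun a = path_fun b -> a = b.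
Proof. exact: val_inj. Qed.

Lemma path_fun_continuous :
  continuous (fun z : PS * I => path_fun z.1 z.2).
Proof.
rewrite (_ : (fun z => _) = uncurry (@path_fun R X x0)); last by apply/funext; case.
apply: continuous_uncurry_regular.
- exact: unit_itv_locally_compact.
- exact: unit_itv_regular.
- exact: initial_continuous.
- by move=> a; exact: (path_funP a).1.
Qed.

Definition to_path (c : I -> X) : PS :=
  if pselect (continuous c /\ c zero = x0) is left h
  then path_space_of (mk_path h.1 h.2 erefl) else path_space_of (cst x0).

Lemma path_fun_to_path c :
  continuous c -> c zero = x0 -> path_fun (to_path c) = c.
Proof. by move=> cc c0; rewrite /to_path; case: pselect => // -[]. Qed.

Lemma to_pathK (a : PS) : to_path (path_fun a) = a.
Proof.
by have [ca a0] := path_funP a; apply: path_space_eqP; exact: path_fun_to_path.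
Qed.

Lemma to_path_continuous (Z : topologicalType) (F : Z * I -> X) :
  continuous F -> (forall z, F (z, zero) = x0) ->
  continuous (fun z => to_path (fun t => F (z, t))).
Proof.
move=> cF F0; apply: continuous_comp_initial.
have [cF1 cF2] := continuous_curry cF.
rewrite (_ : _ \o _ = (curry F : Z -> {compact-open, I -> X})) //.
apply/funext => z /=; apply: (path_fun_to_path (c := curry F z)) => //.
exact: F0.
Qed.

End PathSpaceTopology.

(* Coupling a neighbourhood base with nat leaves no maximal index, so that the
   strict order defining the topology at infinity detects every neighbourhood. *)
Definition nbhd_index (T : topologicalType) (a : T) : Type :=
  (nat * {N : set T | nbhs a N})%type.

Section NeighbourhoodNets.
Context {T : topologicalType} (a : T).
Local Notation J := (nbhd_index a).

HB.instance Definition _ := gen_eqMixin J.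
HB.instance Definition _ := gen_choiceMixin J.

Definition nbhd_index_le (i j : J) : bool :=
  (i.1 <= j.1)%N && `[< sval j.2 `<=` sval i.2 >].

Definition nbhd_index_lt (i j : J) : bool :=
  nbhd_index_le i j && ~~ nbhd_index_le j i.

Lemma nbhd_index_lt_def i j :
  nbhd_index_lt i j = nbhd_index_le i j && ~~ nbhd_index_le j i.
Proof. by []. Qed.

Lemma nbhd_index_le_refl : reflexive nbhd_index_le.
Proof. by move=> i; rewrite /nbhd_index_le leqnn; apply/asboolP. Qed.

Lemma nbhd_index_le_trans : transitive nbhd_index_le.
Proof.
move=> j i k /andP[ij /asboolP Nij] /andP[jk /asboolP Njk].
rewrite /nbhd_index_le (leq_trans ij jk); apply/asboolP.
exact: subset_trans Njk Nij.
Qed.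

HB.instance Definition _ := Order.isPreorder.Build Order.default_display J
  nbhd_index_lt_def nbhd_index_le_refl nbhd_index_le_trans.

Lemma nbhd_index_inhabited : inhabited J.
Proof. by constructor; split; [exact: 0%N|exists setT; exact: filterT]. Qed.

Lemma nbhd_index_ub (i j : J) : exists k : J, (i <= k)%O /\ (j <= k)%O.
Proof.
have Nij : nbhs a (sval i.2 `&` sval j.2) by apply: filterI; exact: svalP.
exists (maxn i.1 j.1, exist _ _ Nij); split; apply/andP; split => /=.
- exact: leq_maxl.
- by apply/asboolP; exact: subIsetl.
- exact: leq_maxr.
- by apply/asboolP; exact: subIsetr.
Qed.

HB.instance Definition _ := isDirected.Build Order.default_display J
  nbhd_index_inhabited nbhd_index_ub.

Definition nbhd_net (S : set T) (k : adjoin_infty J) : T :=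
  if k is Some j then xget a (sval j.2 `&` S) else a.

Lemma nbhd_net_in S (j : J) : sval j.2 (nbhd_net S (Some j)).
Proof.
rewrite /=; case: xgetP => [x _ []//|_].
by apply: nbhs_singleton; exact: (svalP j.2).
Qed.

Lemma infty_nbhd_nbhs (d : Order.disp_t) (D : directedType d) (k : D) :
  nbhs (None : adjoin_infty D) (infty_nbhd k).
Proof.
apply: open_nbhs_nbhs; split; last by left.
exists [set infty_nbhd k]; last exact: bigcup_set1.
by move=> _ ->; right; exists k.
Qed.

Lemma nbhs_inftyE (d : Order.disp_t) (D : directedType d) (U : set (adjoin_infty D)) :
  nbhs (None : adjoin_infty D) U -> exists k, infty_nbhd k `<=` U.
Proof.
rewrite nbhsE => -[V [[F bF <-] [W FW WN]] VU].
case: (bF _ FW) => -[k Wk]; first by rewrite Wk in WN.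
exists k; apply: subset_trans VU => x kx; exists W => //; rewrite Wk; exact: kx.
Qed.

Lemma nbhs_Some (d : Order.disp_t) (D : directedType d) (j : D)
    (U : set (adjoin_infty D)) : U (Some j) -> nbhs (Some j : adjoin_infty D) U.
Proof.
move=> Uj; rewrite nbhsE; exists [set Some j]; last by move=> _ ->.
split=> //; exists [set [set Some j]]; last exact: bigcup_set1.
by move=> _ ->; left; exists j.
Qed.

Lemma nbhd_net_continuous S : continuous (nbhd_net S).
Proof.
case=> [j|] U; first by move=> /nbhs_singleton Uj; exact: nbhs_Some.
move=> aU; pose j : J := (0%N, exist _ U aU).
apply: filterS (infty_nbhd_nbhs j) => _ [->|[k /= jk <-]].
  exact: nbhs_singleton.
have /andP[_ /asboolP] : (j <= k)%O := ltW jk.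
by apply; exact: nbhd_net_in.
Qed.

Lemma nbhd_net_nbhs (W : set T) :
  (forall S, nbhs (None : adjoin_infty J) (nbhd_net S @^-1` W)) -> nbhs a W.
Proof.
move=> /(_ (~` W)) /nbhs_inftyE[[n N] kW].
apply: filterS (svalP N) => x Nx; apply: contrapT => Wx.
have : W (xget a (sval N `&` ~` W)).
  apply: (kW (Some (n.+1, N))); right; exists (n.+1, N) => //=.
  rewrite /Order.lt /= /nbhd_index_lt /nbhd_index_le /= leqnSn ltnn /=.
  by rewrite andbT; apply/asboolP.
by case: xgetP => [y _ []//|/(_ x) []].
Qed.

End NeighbourhoodNets.

Section RawPaths.
Context {R : realType} {X : topologicalType}.
Local Notation I := (unit_itv R).
Implicit Types a b c : I -> X.

Definition is_path c (x y : X) := [/\ continuous c, c zero = x & c one = y].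

Definition concat a b (t : I) : X :=
  if ival t <= 2^-1 then a (clamp (2 * ival t)) else b (clamp (2 * ival t - 1)).

Definition reverse a (t : I) : X := a (clamp (1 - ival t)).

Definition homot a b : Prop :=
  exists h : (I * I)%type -> X,
    [/\ continuous h, forall s, h (s, zero) = a s, forall s, h (s, one) = b s &
        forall t, h (zero, t) = a zero /\ h (one, t) = a one].

Lemma is_path_path x y (p : {path I from x to y}) : is_path p x y.
Proof. by split; [exact: cts_fun|exact: path_zero|exact: path_one]. Qed.

Lemma is_pathP c x y :
  is_path c x y -> exists p : {path I from x to y}, (p : I -> X) = c.
Proof. by case=> cc c0 c1; exists (mk_path cc c0 c1). Qed.

Lemma homotP x y (p q : {path I from x to y}) :
  path_homotopic p q <-> homot p q.
Proof.
by split=> -[h [ch h0 h1 he]]; exists h; split=> // t;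
  have := he t; rewrite path_zero path_one.
Qed.

Lemma is_path_cst x : is_path (cst x) x x.
Proof. exact: (is_path_path (cst x)). Qed.

Lemma is_path_concat a b x y z :
  is_path a x y -> is_path b y z -> is_path (concat a b) x z.
Proof.
move=> /is_pathP[p <-] /is_pathP[q <-]; exact: (is_path_path (path_concat p q)).
Qed.

Lemma is_path_reverse a x y : is_path a x y -> is_path (reverse a) y x.
Proof. by move=> /is_pathP[p <-]; exact: (is_path_path (path_rev p)). Qed.

Lemma reverseK : involutive reverse.
Proof.
move=> a; apply/funext => t; have := ival_itv t => t01.
by rewrite /reverse clampK ?subKr ?ivalK //; lra.
Qed.

Lemma homot_refl a x y : is_path a x y -> homot a a.
Proof. by move=> /is_pathP[p <-]; apply/homotP; exact: path_homotopic_refl. Qed.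

Lemma homot_concat a a' b b' x y z :
  is_path a x y -> is_path a' x y -> is_path b y z -> is_path b' y z ->
  homot a a' -> homot b b' -> homot (concat a b) (concat a' b').
Proof.
move=> /is_pathP[p <-] /is_pathP[p' <-] /is_pathP[q <-] /is_pathP[q' <-].
move=> /homotP pp' /homotP qq'.
by apply/(homotP (path_concat p q) (path_concat p' q'))/path_homotopic_concat.
Qed.

Lemma concat_left a b (t : I) : concat a b (clamp (ival t / 2)) = a t.
Proof.
have t01 := ival_itv t.
rewrite /concat (_ : ival (clamp _) = ival t / 2); last by apply: clampK; lra.
rewrite ifT; last lra.
by rewrite mulrCA mulfV ?pnatr_eq0 // mulr1 ivalK.
Qed.

Lemma concat_right a b (t : I) :
  a one = b zero -> concat a b (clamp ((ival t + 1) / 2)) = b t.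
Proof.
move=> ab; have t01 := ival_itv t.
rewrite /concat (_ : ival (clamp _) = (ival t + 1) / 2); last by apply: clampK; lra.
rewrite (_ : 2 * _ = ival t + 1); last lra.
case: ifP => t12; last by rewrite addrK ivalK.
have t0 : ival t = 0 by lra.
by rewrite t0 add0r -[t]ivalK t0 -[clamp 1]/one ab.
Qed.

End RawPaths.

Section RawPathsComp.
Context {R : realType} {X Y : topologicalType} (f : X -> Y).
Local Notation I := (unit_itv R).

Lemma comp_concat (a b : I -> X) : f \o concat a b = concat (f \o a) (f \o b).
Proof. by apply/funext => t; rewrite /concat /=; case: ifP. Qed.

Lemma comp_reverse (a : I -> X) : f \o reverse a = reverse (f \o a).
Proof. by []. Qed.

Lemma is_path_comp (a : I -> X) x y :
  continuous f -> is_path a x y -> is_path (f \o a) (f x) (f y).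
Proof.
by move=> cf [ca <- <-]; split => //; exact: cont_comp.
Qed.

End RawPathsComp.

Section InitialArc.
Context {R : realType} {X : topologicalType}.
Local Notation I := (unit_itv R).

Definition initial_arc (c : I -> X) (t s : I) : X := c (clamp (ival t * ival s)).

Lemma initial_arc_zero c t : initial_arc c t zero = c zero.
Proof. by rewrite /initial_arc ival0 mulr0. Qed.

Lemma initial_arc_one c t : initial_arc c t one = c t.
Proof. by rewrite /initial_arc ival1 mulr1 ivalK. Qed.

Lemma initial_arc_at0 c : initial_arc c zero = cst (c zero).
Proof. by apply/funext => s; rewrite /initial_arc ival0 mul0r. Qed.

Lemma initial_arc_at1 c : initial_arc c one = c.
Proof. by apply/funext => s; rewrite /initial_arc ival1 mul1r ivalK. Qed.

Lemma initial_arc_continuous c : continuous c ->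
  continuous (fun z : I * I => initial_arc c z.1 z.2).
Proof. by move=> cc; apply: cont_comp; last exact: cc; cont. Qed.

Lemma is_path_initial_arc c x y t :
  is_path c x y -> is_path (initial_arc c t) x (c t).
Proof.
case=> cc c0 _; split; [|by rewrite initial_arc_zero|exact: initial_arc_one].
by apply: cont_comp; last exact: cc; cont.
Qed.

End InitialArc.

Section PathClass.
Context {R : realType} {X : topologicalType} {x0 : X}.
Context (H : groupClosed (pi1 R x0)).
Local Notation I := (unit_itv R).
Implicit Types a b c : I -> X.

Definition path_class (c : I -> X) : Xtilde H := \pi_(Xtilde H) (to_path c).

Lemma path_class_eq y (p q : {path I from x0 to y}) :
  path_class p = path_class q <->
  \pi_(pi1 R x0) (path_concat p (path_rev q)) \in H.
Proof.
have pE : path_fun (to_path (x0 := x0) p) = p.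
  by apply: path_fun_to_path; [exact: cts_fun|exact: path_zero].
have qE : path_fun (to_path (x0 := x0) q) = q.
  by apply: path_fun_to_path; [exact: cts_fun|exact: path_zero].
split=> [/eqmodP/asboolP[z [p' [q' [pp' qq' Hpq]]]]|Hpq]; last first.
  by apply/eqmodP/asboolP; exists y, p, q.
have yz : y = z by rewrite -[z](path_one (s := p')) -pp' pE path_one.
subst z; have -> : p = p' by apply/path_eqP => t; rewrite -pp' pE.
by have -> : q = q' by apply/path_eqP => t; rewrite -qq' qE.
Qed.

Lemma path_classP a b y : is_path a x0 y -> is_path b x0 y ->
  path_class a = path_class b <->
  exists l : {path I from x0 to x0},
    (l : I -> X) = concat a (reverse b) /\ \pi_(pi1 R x0) l \in H.
Proof.
move=> /is_pathP[p <-] /is_pathP[q <-]; rewrite path_class_eq.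
split=> [Hpq|[l [lE Hl]]]; first by exists (path_concat p (path_rev q)).
suff -> : path_concat p (path_rev q) = l :> {path I from x0 to x0} by [].
by apply/path_eqP => t; rewrite lE.
Qed.

Lemma path_class_homot a b y : is_path a x0 y -> is_path b x0 y ->
  homot a b -> path_class a = path_class b.
Proof.
move=> /is_pathP[p <-] /is_pathP[q <-] /homotP pq; apply/path_class_eq.
rewrite (_ : \pi_(pi1 R x0) _ = 1%g); first exact: gpred1.
apply/pi1P; apply: (path_homotopic_trans _ (path_concat_revr q)).
by apply: path_homotopic_concat => //; exact: path_homotopic_refl.
Qed.

Lemma path_class_concatA a b c x y z :
  is_path a x0 x -> is_path b x y -> is_path c y z ->
  path_class (concat a (concat b c)) = path_class (concat (concat a b) c).
Proof.
move=> pa pb pc; apply: (@path_class_homot _ _ z).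
- by do ?apply: is_path_concat; eassumption.
- by apply: is_path_concat pc; apply: is_path_concat pb.
move: pa pb pc => /is_pathP[p <-] /is_pathP[q <-] /is_pathP[r <-].
apply/(homotP (path_concat p (path_concat q r))
              (path_concat (path_concat p q) r)).
exact: path_concatA.
Qed.

Lemma path_class_concatr a b c y z :
  is_path a x0 y -> is_path b x0 y -> is_path c y z ->
  path_class a = path_class b -> path_class (concat a c) = path_class (concat b c).
Proof.
move=> /is_pathP[p <-] /is_pathP[q <-] /is_pathP[r <-] /path_class_eq Hpq.
apply/(path_class_eq (path_concat p r) (path_concat q r)).
rewrite (_ : \pi_(pi1 R x0) _ = \pi_(pi1 R x0) (path_concat p (path_rev q))) //.
apply/pi1P.
have E : path_rev (path_concat q r) =
    path_concat (path_rev r) (path_rev q) :> {path I from z to x0}.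
  by apply/path_eqP => t; exact: path_rev_concat.
rewrite E.
apply: (path_homotopic_trans (path_homotopic_sym (path_concatA _ _ _))).
apply: path_homotopic_concat; first exact: path_homotopic_refl.
apply: (path_homotopic_trans (path_concatA _ _ _)).
apply: (path_homotopic_trans _ (path_concat_cstl _)).
apply: path_homotopic_concat; last exact: path_homotopic_refl.
exact: path_concat_revr.
Qed.

Lemma path_class_concat_cst a y : is_path a x0 y ->
  path_class (concat a (cst y)) = path_class a.
Proof.
move=> pa; apply: (@path_class_homot _ _ y) => //.
  by apply: is_path_concat pa _; exact: is_path_cst.
move: pa => /is_pathP[p <-].
by apply/(homotP (path_concat p (cst y)) p); exact: path_concat_cstr.
Qed.

Lemma path_class_concat_reverse a b y z : is_path a x0 y -> is_path b y z ->
  path_class (concat a (concat b (reverse b))) = path_class a.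
Proof.
move=> pa pb; rewrite -[RHS](path_class_concat_cst pa).
apply: (@path_class_homot _ _ y).
- by apply: is_path_concat pa _; exact: is_path_concat pb (is_path_reverse pb).
- by apply: is_path_concat pa _; exact: is_path_cst.
move: pa pb => /is_pathP[p <-] /is_pathP[q <-].
apply/(homotP (path_concat p (path_concat q (path_rev q))) (path_concat p (cst y))).
apply: path_homotopic_concat; first exact: path_homotopic_refl.
exact: path_concat_revr.
Qed.

Lemma path_class_cst : path_class (cst x0) = Xtilde_base H.
Proof.
rewrite /path_class /Xtilde_base; congr (\pi_(Xtilde H) _); apply: path_space_eqP.
by rewrite path_fun_to_path //; exact: cst_continuous.
Qed.

Lemma path_class_loop (p : {path I from x0 to x0}) :
  path_class p = Xtilde_base H <-> \pi_(pi1 R x0) p \in H.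
Proof.
rewrite -path_class_cst (path_class_eq p (cst x0)).
rewrite (_ : \pi_(pi1 R x0) (path_concat _ _) = \pi_(pi1 R x0) p) //.
apply/pi1P; apply: (path_homotopic_trans _ (path_concat_cstr p)).
by apply: path_homotopic_concat; [exact: path_homotopic_refl|apply: path_homotopic_eq].
Qed.

Lemma pH_path_class a y : is_path a x0 y -> pH H (path_class a) = y.
Proof. by case=> ca a0 a1; rewrite pHE path_fun_to_path. Qed.

Lemma path_class_surj (u : Xtilde H) :
  exists2 a, is_path a x0 (pH H u) & u = path_class a.
Proof.
exists (path_fun (repr u)).
  by have [ca a0] := path_funP (repr u); split.
by rewrite /path_class to_pathK reprK.
Qed.

Lemma path_class_continuous (Z : topologicalType) (F : Z * I -> X) :
  continuous F -> (forall z, F (z, zero) = x0) ->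
  continuous (fun z => path_class (fun t => F (z, t))).
Proof.
move=> cF F0; apply: (cont_comp (g := \pi_(Xtilde H))).
  exact: to_path_continuous.
exact: pi_continuous.
Qed.

Definition standard_lift (a : I -> X) (t : I) : Xtilde H :=
  path_class (initial_arc a t).

Lemma is_path_standard_lift a y : is_path a x0 y ->
  is_path (standard_lift a) (Xtilde_base H) (path_class a).
Proof.
case=> ca a0 a1; split.
- apply: (path_class_continuous (F := fun z => initial_arc a z.1 z.2)).
    exact: initial_arc_continuous.
  by move=> z; rewrite /= initial_arc_zero.
- by rewrite /standard_lift initial_arc_at0 a0 path_class_cst.
- by rewrite /standard_lift initial_arc_at1.
Qed.

Lemma pH_standard_lift a y : is_path a x0 y -> pH H \o standard_lift a = a.
Proof.
by move=> pa; apply/funext => t; apply: pH_path_class; exact: is_path_initial_arc pa.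
Qed.

End PathClass.

Section QuotientMaps.

Lemma quotient_map_continuous (S X W : topologicalType) (q : S -> X) (g : X -> W) :
  quotient_map q -> continuous (g \o q) -> continuous g.
Proof.
move=> [_ oq] cgq; apply/continuousP => U oU; apply/oq.
by have /continuousP := cgq; apply.
Qed.

Lemma quotient_map_is_continuous (S X : topologicalType) (q : S -> X) :
  quotient_map q -> continuous q.
Proof. by move=> [_ oq]; apply/continuousP => U /oq. Qed.

Lemma retraction_quotient_map (S X : topologicalType) (q : S -> X) (s : X -> S) :
  continuous q -> continuous s -> cancel s q -> quotient_map q.
Proof.
move=> cq cs sK; split=> [x|U]; first by exists (s x).
split=> [oU|oqU]; first by have /continuousP := cq; apply.
have -> : U = s @^-1` (q @^-1` U).
  by apply/seteqP; split => x /=; rewrite sK.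
by have /continuousP := cs; apply.
Qed.

Lemma existT_quotient_map (X : topologicalType) (A : choiceType)
    (T : A -> topologicalType) (q : forall a, T a -> X) :
  (forall a, continuous (q a)) ->
  (forall x, exists a t, q a t = x) ->
  (forall U : set X, (forall a, open (q a @^-1` U)) -> open U) ->
  quotient_map (fun z : {a : A & T a} => q (projT1 z) (projT2 z)).
Proof.
move=> cq sq oq; split=> [x|U].
  by have [a [t <-]] := sq x; exists (existT _ a t).
split=> [oU|/sigT_openP oU].
  by apply/sigT_openP => a; have /continuousP := cq a; apply.
by apply: oq => a; exact: oU.
Qed.

End QuotientMaps.

Section PathConnected.
Context {R : realType} {X : topologicalType}.

Lemma path_connectedP :
  path_connected R X <-> forall x y : X, exists c : unit_itv R -> X, is_path c x y.
Proof.
split=> pX x y; first by have [p] := pX x y; exists p; exact: is_path_path.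
by have [c /is_pathP[p _]] := pX x y.
Qed.

Lemma path_connected_from (v : X) :
  (forall x, exists c : unit_itv R -> X, is_path c v x) -> path_connected R X.
Proof.
move=> pX; apply/path_connectedP => x y.
have [a pa] := pX x; have [b pb] := pX y.
by exists (concat (reverse a) b); exact: is_path_concat (is_path_reverse pa) pb.
Qed.

End PathConnected.

Section Disk.
Context {R : realType}.
Local Notation I := (unit_itv R).
Local Notation D := (unit_disk R).

Lemma disk_scale_in (z : D) (s : I) :
  (ival s * (\val z).1, ival s * (\val z).2)
    \in [set z : R * R | z.1 ^+ 2 + z.2 ^+ 2 <= 1].
Proof.
rewrite inE /=; have := set_valP z; rewrite /= => z1.
rewrite !exprMn -mulrDr; apply: mulr_ile1 => //; first exact: sqr_ge0.
  by rewrite addr_ge0 ?sqr_ge0.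
by rewrite expr_le1 ?ival_ge0 ?ival_le1.
Qed.

Definition disk_scale (w : D * I) : D :=
  exist (fun z : R * R => z \in _) _ (disk_scale_in w.1 w.2).

Lemma disk_val_continuous : continuous (fun z : D => \val z : R * R).
Proof. exact: initial_continuous. Qed.

Lemma continuous_disk (Z : topologicalType) (f : Z -> D) :
  continuous (fun z => \val (f z) : R * R) -> continuous f.
Proof. exact: continuous_comp_initial. Qed.

Lemma disk_scale_continuous : continuous disk_scale.
Proof.
have cv : continuous (fun w : D * I => \val w.1 : R * R).
  by apply: cont_comp; [exact: cont_fst|exact: disk_val_continuous].
apply: continuous_disk; rewrite /=.
by apply: cont_pair; apply: contM; try (by cont);
  apply: (cont_comp cv); [exact: cont_fst|exact: cont_snd].
Qed.

Lemma disk_scale0 z w : disk_scale (z, zero) = disk_scale (w, zero).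
Proof. by apply: val_inj; rewrite /= ival0 !mul0r. Qed.

Lemma disk_scale1 z : disk_scale (z, one) = z.
Proof. by apply: val_inj; rewrite /= ival1 !mul1r -surjective_pairing. Qed.

Lemma disk_square_in (s t : I) :
  (ival s / 2, ival t / 2) \in [set z : R * R | z.1 ^+ 2 + z.2 ^+ 2 <= 1].
Proof.
rewrite inE /=.
have := ival_itv s; have := ival_itv t; move: (ival s) (ival t) => x y Hx Hy.
have : x ^+ 2 <= 1 by rewrite expr_le1 //; lra.
have : y ^+ 2 <= 1 by rewrite expr_le1 //; lra.
by rewrite !exprMn; lra.
Qed.

Definition disk_of_square (z : I * I) : D :=
  exist (fun z : R * R => z \in _) _ (disk_square_in z.1 z.2).

Definition square_of_disk (z : D) : I * I :=
  (clamp (2 * (\val z).1), clamp (2 * (\val z).2)).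

Lemma disk_of_square_continuous : continuous disk_of_square.
Proof. by apply: continuous_disk => /=; cont. Qed.

Lemma square_of_disk_continuous : continuous square_of_disk.
Proof.
by apply: cont_pair; apply: cont_clamp; apply: contM; try (by cont);
  apply: (cont_comp disk_val_continuous); [exact: cont_fst|exact: cont_snd].
Qed.

Lemma disk_of_squareK : cancel disk_of_square square_of_disk.
Proof.
have half (x : R) : 2 * (x / 2) = x by lra.
by move=> [s t]; rewrite /square_of_disk /= !half !ivalK.
Qed.

Lemma in_Fan_disk_retract (X : topologicalType) (q : D -> X) (s : X -> D) :
  path_connected R X -> continuous q -> continuous s -> cancel s q -> in_Fan R X.
Proof.
move=> pX cq cs sK; split => //.
have [sq oq] := retraction_quotient_map cq cs sK.
exists unit, (fun _ => Disk), (fun z => q (projT2 z)).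
apply: (@existT_quotient_map _ _ (fun _ => fan_piece_space R Disk) (fun _ => q)) => //.
by move=> U /(_ tt) /oq.
Qed.

Lemma in_Fan_square : in_Fan R (I * I)%type.
Proof.
apply: in_Fan_disk_retract disk_of_squareK.
- apply: (path_connected_from (v := (zero, zero))) => -[s t].
  exists (fun u => (clamp (ival u * ival s), clamp (ival u * ival t))); split.
  + by cont.
  + by rewrite ival0 !mul0r.
  + by rewrite ival1 !mul1r !ivalK.
- exact: square_of_disk_continuous.
- exact: disk_of_square_continuous.
Qed.

Lemma in_Fan_itv : in_Fan R I.
Proof.
apply: (@in_Fan_disk_retract _ (fst \o square_of_disk)
          (fun t => disk_of_square (t, zero))).
- apply: (path_connected_from (v := zero)) => t.
  exists (fun u => clamp (ival u * ival t)); split.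
  + by cont.
  + by rewrite ival0 mul0r.
  + by rewrite ival1 mul1r ivalK.
- by apply: (cont_comp square_of_disk_continuous); exact: cont_fst.
- apply: cont_comp disk_of_square_continuous; apply: cont_pair; first exact: cont_id.
  exact: cst_continuous.
- by move=> t; exact: (congr1 fst (disk_of_squareK (t, zero))).
Qed.

End Disk.

Section ArcFanTopology.
Context {R : realType} {d : Order.disp_t} {J : directedType d}.
Local Notation I := (unit_itv R).
Local Notation K := (adjoin_infty J).
Local Notation F := (arc_fan R J).

Definition fan_point (z : K * I) : F := \pi_F z.

Lemma fan_point_continuous : continuous fan_point.
Proof. exact: pi_continuous. Qed.

Lemma fan_point_surj (u : F) : exists z, fan_point z = u.
Proof. by exists (repr u); rewrite /fan_point reprK. Qed.

Lemma fan_point_vertex k l : fan_point (k, zero) = fan_point (l, zero).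
Proof. by apply/eqmodP; rewrite /= /cone_equiv /= eqxx orbT. Qed.

Lemma continuous_fan (Z : topologicalType) (g : F -> Z) :
  continuous (g \o fan_point) -> continuous g.
Proof. by move=> cg; exact/(quotient_continuous g). Qed.

Lemma fan_lift (Z : topologicalType) (f : K * I -> Z) :
  continuous f -> (forall k l, f (k, zero) = f (l, zero)) ->
  exists g : F -> Z, continuous g /\ forall z, g (fan_point z) = f z.
Proof.
move=> cf f0; have E z : f (repr (fan_point z)) = f z.
  have /eqmodP : repr (fan_point z) = z %[mod F] by exact: reprK.
  rewrite /= /cone_equiv => /orP[/eqP -> //|/andP[]].
  by case: (repr _) => k s; case: z => l t /= /eqP -> /eqP ->; exact: f0.
exists (f \o repr); split => //.
apply: continuous_fan; rewrite (_ : _ \o _ = f) //.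
by apply/funext => z /=; exact: E.
Qed.

Definition fan_vertex : F := fan_point (None, zero).

Lemma fan_radius_continuous :
  continuous (fun z : (K * I) * I => fan_point (z.1.1, clamp (ival z.2 * ival z.1.2))).
Proof.
have c1 : continuous (fun z : (K * I) * I => z.1.1).
  by apply: (cont_comp (f := fst) (g := fst)); exact: cont_fst.
have c2 : continuous (fun z : (K * I) * I => z.1.2).
  by apply: (cont_comp (f := fst) (g := snd)); [exact: cont_fst|exact: cont_snd].
apply: cont_comp fan_point_continuous; apply: cont_pair; first exact: c1.
by apply: cont_clamp; apply: contM; apply: cont_ival; [exact: cont_snd|exact: c2].
Qed.

Lemma fan_radius_path (z : K * I) :
  is_path (fun s : I => fan_point (z.1, clamp (ival s * ival z.2)))
    fan_vertex (fan_point z).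
Proof.
split.
- apply: (cont_comp (f := fun s => (z, s)) _ fan_radius_continuous).
  by apply: cont_pair; [exact: cst_continuous|exact: cont_id].
- by rewrite ival0 mul0r; exact: fan_point_vertex.
- by rewrite ival1 mul1r ivalK -surjective_pairing.
Qed.

Lemma arc_fan_path_connected : path_connected R F.
Proof.
apply: (path_connected_from (v := fan_vertex)) => u.
have [z <-] := fan_point_surj u; eexists; exact: fan_radius_path.
Qed.

Lemma in_Fan_arc_fan : in_Fan R F.
Proof.
split; first exact: arc_fan_path_connected.
exists unit, (fun _ => ArcFan J), (fun z => projT2 z).
apply: (@existT_quotient_map _ _ (fun _ => fan_piece_space R (ArcFan J))
          (fun _ => idfun)).
- by move=> _; exact: cont_id.
- by move=> x; exists tt, x.
- by move=> U /(_ tt).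
Qed.

End ArcFanTopology.

(* Disks and arc-fans are radially contracted to a point, so continuity on a
   space in Fan can be tested along maps that spread out from a point. *)
Lemma in_Fan_continuous (R : realType) (Y W : topologicalType) (g : Y -> W) :
  in_Fan R Y ->
  (forall (Z : topologicalType) (r : Z * unit_itv R -> Y) (v : Y),
     continuous r -> (forall z, r (z, zero) = v) ->
     continuous (fun z => g (r (z, one)))) ->
  continuous g.
Proof.
move=> [_ [A [P [q qq]]]] radial.
apply: (quotient_map_continuous qq); apply/continuousP => U oU.
apply/sigT_openP => a; pose h t := q (existT (fun a => fan_piece_space R (P a)) a t).
have ch : continuous h.
  by apply: (cont_comp (@existT_continuous _ _ a)); exact: quotient_map_is_continuous.
suff cgh : continuous (g \o h) by have /continuousP := cgh; apply.
move: (P a) h ch => [|d J] h ch {q qq}.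
- have cr : continuous (fun w => h (disk_scale w)).
    by apply: cont_comp ch; exact: disk_scale_continuous.
  have z0 : unit_disk R := disk_of_square (zero, zero).
  have := radial _ _ (h (disk_scale (z0, zero))) cr.
  have -> : (fun z => g (h (disk_scale (z, one)))) = g \o h.
    by apply/funext => z; rewrite disk_scale1.
  by apply=> z; rewrite (disk_scale0 z z0).
- apply: continuous_fan.
  have cr : continuous (fun w : (adjoin_infty J * unit_itv R) * unit_itv R =>
      h (fan_point (w.1.1, clamp (ival w.2 * ival w.1.2)))).
    by apply: cont_comp ch; exact: fan_radius_continuous.
  have := radial _ _ (h fan_vertex) cr.
  have -> : (fun z : adjoin_infty J * unit_itv R =>
      g (h (fan_point (z.1, clamp (ival one * ival z.2))))) = (g \o h) \o fan_point.
    by apply/funext => -[k t]; rewrite /= ival1 mul1r ivalK.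
  apply=> z; rewrite /= ival0 mul0r; congr h; exact: fan_point_vertex.
Qed.

Section FanOfPaths.
Context {R : realType} {X : topologicalType} {x0 : X}.
Local Notation I := (unit_itv R).
Local Notation PS := (@path_space R X x0).

Lemma to_path_initial_arc_continuous :
  continuous (fun z : PS * I => to_path (initial_arc (path_fun z.1) z.2) : PS).
Proof.
apply: (to_path_continuous
          (F := fun w : (PS * I) * I => initial_arc (path_fun w.1.1) w.1.2 w.2)).
  have c11 : continuous (fun w : (PS * I) * I => w.1.1).
    by apply: (cont_comp (f := fst) (g := fst)); exact: cont_fst.
  have c12 : continuous (fun w : (PS * I) * I => w.1.2).
    by apply: (cont_comp (f := fst) (g := snd)); [exact: cont_fst|exact: cont_snd].
  apply: (cont_comp _ path_fun_continuous
            (f := fun w : (PS * I) * I => (w.1.1, clamp (ival w.1.2 * ival w.2)))).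
  apply: cont_pair; first exact: c11.
  by apply: cont_clamp; apply: contM; apply: cont_ival; [exact: c12|exact: cont_snd].
by case=> a t; rewrite /= initial_arc_zero (path_funP a).2.
Qed.

Lemma path_fun_initial_arc (a : PS) t :
  path_fun (to_path (initial_arc (path_fun a) t) : PS) = initial_arc (path_fun a) t.
Proof.
have [ca a0] := path_funP a; apply: path_fun_to_path.
  by apply: cont_comp; last exact: ca; cont.
by rewrite initial_arc_zero.
Qed.

Lemma path_fan (d : Order.disp_t) (J : directedType d) (k : adjoin_infty J -> PS) :
  continuous k ->
  exists g : arc_fan R J -> PS, continuous g /\
    forall j t, g (fan_point (j, t)) = to_path (initial_arc (path_fun (k j)) t).
Proof.
move=> ck.
have [||g [cg gE]] := @fan_lift R _ J _
  (fun z => to_path (initial_arc (path_fun (k z.1)) z.2) : PS).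
- apply: (cont_comp _ to_path_initial_arc_continuous (f := fun z => (k z.1, z.2))).
  apply: cont_pair; last exact: cont_snd.
  by apply: cont_comp ck; exact: cont_fst.
- by move=> i j; rewrite /= !initial_arc_at0 !(path_funP _).2.
by exists g; split=> // j t; rewrite gE.
Qed.

Lemma in_Fan_Xtilde (H : groupClosed (pi1 R x0)) : in_Fan R (Xtilde H).
Proof.
split.
  apply: (path_connected_from (v := Xtilde_base H)) => u.
  have [a pa ->] := path_class_surj u.
  by exists (standard_lift H a); exact: is_path_standard_lift pa.
pose A : choiceType := (PS * set PS)%type.
have fan_at (w : A) := cid (path_fan (@nbhd_net_continuous _ w.1 w.2)).
pose g (w : A) u : Xtilde H := \pi_(Xtilde H) (projT1 (fan_at w) u).
have gE w k t : g w (fan_point (k, t)) =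
    \pi_(Xtilde H) (to_path (initial_arc (path_fun (nbhd_net w.2 k)) t)).
  by rewrite /g; have [_ ->] := projT2 (fan_at w).
have gE1 w k : g w (fan_point (k, one)) = \pi_(Xtilde H) (nbhd_net w.2 k).
  by rewrite gE initial_arc_at1 to_pathK.
have cg w : continuous (g w).
  have [cgw _] := projT2 (fan_at w).
  by apply: cont_comp cgw _; exact: pi_continuous.
exists A, (fun w => ArcFan (nbhd_index w.1)), (fun z => g (projT1 z) (projT2 z)).
apply: (@existT_quotient_map _ _
  (fun w : A => fan_piece_space R (ArcFan (nbhd_index w.1))) g) => // [u|U oU].
  exists (repr u, set0), (fan_point (None, one)).
  by rewrite gE1 /= reprK.
rewrite /open /= /quotient_open openE => a Ua.
apply: nbhd_net_nbhs => S.
have oK : open ((fun k : adjoin_infty (nbhd_index a) => g (a, S) (fan_point (k, one))) @^-1` U).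
  have ck : continuous (fun k : adjoin_infty (nbhd_index a) => fan_point (k, one : I)).
    by apply: cont_comp (@fan_point_continuous _ _ _); apply: cont_pair;
      [exact: cont_id|exact: cst_continuous].
  by have /continuousP/(_ _ (oU (a, S))) := ck.
apply: open_nbhs_nbhs; split; last by [].
by move: oK; congr open; apply/funext => k /=; rewrite gE1.
Qed.

End FanOfPaths.

Section Coverings.
Context {R : realType}.
Local Notation I := (unit_itv R).

Lemma range_pi1_mapP (X Y : topologicalType) (x : X) (y : Y)
    (f : continuousType X Y) (fx : f x = y) (p : {path I from y to y}) :
  range (pi1_map R fx) (\pi_(pi1 R y) p) <->
  exists2 b, is_path b x x & homot (f \o b) p.
Proof.
split=> [[u _]|[b /is_pathP[q <-] qp]].
  elim/quotW: u => q; rewrite pi1_mapE => /pi1P/homotP qp.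
  by exists q => //; exact: is_path_path.
exists (\pi_(pi1 R x) q) => //; rewrite pi1_mapE; apply/pi1P/homotP; exact: qp.
Qed.

Definition as_continuous (X Y : topologicalType) (f : X -> Y) (cf : continuous f) :
  X -> Y := let _ := cf in f.

HB.instance Definition _ (X Y : topologicalType) (f : X -> Y) (cf : continuous f) :=
  isContinuous.Build X Y (as_continuous cf) cf.

Section Lift.
Context {E X : topologicalType} (p : continuousType E X).

Lemma Fan_covering_lift (Y : topologicalType) (f : Y -> X) (e : E) (y : Y) :
  Fan_covering R p -> continuous f -> f y = p e -> in_Fan R Y ->
  (forall c : I -> Y, is_path c y y -> exists2 b, is_path b e e & homot (p \o b) (f \o c)) ->
  exists g : Y -> E, [/\ continuous g, g y = e, p \o g = f &
    forall g' : Y -> E, continuous g' -> g' y = e -> p \o g' = f -> g' = g].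
Proof.
move=> [_ univ] cf fy FY lift_loops.
have [|g [[gy gf] gU]] := univ Y e y (as_continuous cf) fy FY; last first.
  exists g; split => //; first exact: cts_fun.
  move=> g' cg' g'y g'f.
  by rewrite (gU (as_continuous cg')).
elim/quotW => l /range_pi1_mapP[c pc cl].
apply/range_pi1_mapP; have [b pb bc] := lift_loops c pc; exists b => //.
have pbl : is_path (p \o b) (p e) (p e) by apply: is_path_comp pb; exact: cts_fun.
have pcl : is_path (f \o c) (p e) (p e) by rewrite -fy; exact: is_path_comp.
have {}cl : homot (f \o c) l := cl.
move: bc cl; have [q <-] := is_pathP pbl; have [r <-] := is_pathP pcl.
move=> /homotP bc /homotP cl.
by apply/homotP; exact: path_homotopic_trans bc cl.
Qed.

Lemma Fan_covering_intro :
  in_Fan R E -> unique_path_lifting R p ->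
  (forall (Y : topologicalType) (f : Y -> X) (e : E) (y : Y),
    continuous f -> f y = p e -> in_Fan R Y ->
    (forall c : I -> Y, is_path c y y -> exists2 b, is_path b e e & homot (p \o b) (f \o c)) ->
    exists g : Y -> E, [/\ continuous g, g y = e & p \o g = f]) ->
  Fan_covering R p.
Proof.
move=> FE upl lift; split=> // Y e y f fy FY sub.
have cf : continuous f by exact: cts_fun.
have [c pc|g [cg gy gf]] := lift Y f e y cf fy FY.
  have pfc : is_path (f \o c) (p e) (p e) by rewrite -fy; exact: is_path_comp.
  have [l lE] := is_pathP pfc; rewrite -lE; apply/(range_pi1_mapP (erefl (p e))).
  apply: sub; apply/range_pi1_mapP; exists c => //.
  by rewrite -lE; exact: homot_refl (is_path_path l).
exists (as_continuous cg); split; first by [].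
move=> g' [g'y g'f]; apply/continuousEP => z /=.
have [/path_connectedP pY _] := FY; have [c pc] := pY y z.
have [cc c0 c1] := pc.
pose a : continuousType I E := as_continuous (cont_comp cc cg).
pose b : continuousType I E := as_continuous (cont_comp cc (@cts_fun _ _ g')).
have : a = b.
  apply: upl; last by rewrite /= /as_continuous c0 gy g'y.
  apply/funext => t /=; rewrite /as_continuous.
  by rewrite -[LHS]/((p \o g) (c t)) -[RHS]/((p \o g') (c t)) gf g'f.
by move=> /(congr1 (fun h : continuousType I E => h one)) /=; rewrite /as_continuous c1.
Qed.

End Lift.
End Coverings.

Section CoveringLifts.
Context {R : realType} {E X : topologicalType} (p : continuousType E X).
Hypothesis covp : Fan_covering R p.
Local Notation I := (unit_itv R).

Lemma Fan_covering_lift_contraction (Y : topologicalType) (f : Y -> X)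
    (e : E) (y : Y) (r : Y * I -> X) :
  in_Fan R Y -> continuous r -> (forall z, r (z, one) = f z) ->
  (forall z, r (z, zero) = p e) -> (forall t, r (y, t) = p e) ->
  exists g : Y -> E, [/\ continuous g, g y = e, p \o g = f &
    forall g' : Y -> E, continuous g' -> g' y = e -> p \o g' = f -> g' = g].
Proof.
move=> FY cr r1 r0 ry; apply: (Fan_covering_lift covp) => //.
- rewrite (_ : f = fun z => r (z, one)); last by apply/funext.
  by apply: (cont_comp _ cr); apply: cont_pair; [exact: cont_id|exact: cst_continuous].
- by rewrite -r1 ry.
move=> c [cc c0 c1]; exists (cst e); first exact: is_path_cst.
exists (fun z => r (c z.1, z.2)); split.
- apply: (cont_comp _ cr (f := fun z : I * I => (c z.1, z.2))).
  by apply: cont_pair; [apply: (cont_comp (f := fst)) => //; exact: cont_fst|exact: cont_snd].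
- by move=> s; rewrite r0.
- by move=> s; rewrite r1.
- by move=> t; rewrite /= c0 c1 !ry.
Qed.

Lemma Fan_covering_path_lift (a : I -> X) (e : E) :
  continuous a -> a zero = p e ->
  exists l : I -> E, [/\ continuous l, l zero = e, p \o l = a &
    forall l' : I -> E, continuous l' -> l' zero = e -> p \o l' = a -> l' = l].
Proof.
move=> ca a0.
apply: (@Fan_covering_lift_contraction I a e zero (fun z => initial_arc a z.1 z.2)).
- exact: in_Fan_itv.
- exact: initial_arc_continuous.
- by move=> t; rewrite /= initial_arc_one.
- by move=> t; rewrite /= initial_arc_zero.
- by move=> t; rewrite /= initial_arc_at0.
Qed.

Lemma Fan_covering_eq_lift (a b : I -> E) :
  continuous a -> continuous b -> p \o a = p \o b -> a zero = b zero -> a = b.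
Proof.
move=> ca cb ab ab0.
have [||l [_ _ _ lU]] := @Fan_covering_path_lift (p \o a) (a zero).
- by apply: cont_comp ca _; exact: cts_fun.
- by [].
by rewrite (lU a) // (lU b).
Qed.

Lemma Fan_covering_upl : unique_path_lifting R p.
Proof.
move=> a b ab ab0; apply/continuousEP/funeqP.
by apply: Fan_covering_eq_lift => //; exact: cts_fun.
Qed.

Lemma Fan_covering_homotopy_lift (h : I * I -> X) (e : E) :
  continuous h -> h (zero, zero) = p e ->
  exists g : I * I -> E, [/\ continuous g, g (zero, zero) = e & p \o g = h].
Proof.
move=> ch h0.
have [|||||g [cg g0 gh _]] := @Fan_covering_lift_contraction (I * I)%type h e
  (zero, zero)
  (fun z => h (clamp (ival z.2 * ival z.1.1), clamp (ival z.2 * ival z.1.2))).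
- exact: in_Fan_square.
- have c1 : continuous (fun z : (I * I) * I => z.1.1).
    by apply: (cont_comp (f := fst) (g := fst)); exact: cont_fst.
  have c2 : continuous (fun z : (I * I) * I => z.1.2).
    by apply: (cont_comp (f := fst) (g := snd)); [exact: cont_fst|exact: cont_snd].
  apply: cont_comp ch; apply: cont_pair; apply: cont_clamp; apply: contM;
    apply: cont_ival; try exact: cont_snd; [exact: c1|exact: c2].
- by case=> s t; rewrite /= ival1 !mul1r !ivalK.
- by move=> z; rewrite /= ival0 !mul0r.
- by move=> t; rewrite /= ival0 !mulr0.
by exists g.
Qed.

End CoveringLifts.

Section SubgroupPaths.
Context {R : realType} {X : topologicalType} {x0 : X} (H : groupClosed (pi1 R x0)).
Local Notation I := (unit_itv R).

Lemma is_path_pH (b : I -> Xtilde H) u :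
  is_path b (Xtilde_base H) u -> is_path (pH H \o b) x0 (pH H u).
Proof.
move=> pb; have cp : continuous (pH H) by exact: cts_fun.
by have := is_path_comp cp pb; rewrite (pH_base H).
Qed.

Lemma upl_range : unique_path_lifting R (pH H) ->
  range (pi1_map R (pH_base H)) = [set` H].
Proof.
move=> upl; apply/seteqP; split; elim/quotW => l /=; rewrite -path_class_loop.
  move=> /range_pi1_mapP[b pb bl].
  have pHb : is_path (pH H \o b) x0 x0.
    by have := is_path_pH pb; rewrite (pH_base H).
  rewrite -(path_class_homot H pHb (is_path_path l) bl).
  have [cb b0 b1] := pb; have [cs s0 s1] := is_path_standard_lift H pHb.
  have /(congr1 (fun g : continuousType I (Xtilde H) => g one)) :
      (as_continuous cs : continuousType I _) = as_continuous cb.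
    apply: upl; last by rewrite /= /as_continuous s0 b0.
    exact: (pH_standard_lift H pHb).
  by rewrite /= /as_continuous s1 b1.
move=> lH; apply/range_pi1_mapP; have pl := is_path_path l.
exists (standard_lift H l); last by rewrite (pH_standard_lift H pl); exact: homot_refl pl.
by rewrite -{2}lH; exact: is_path_standard_lift pl.
Qed.

Section RangeEq.
Hypothesis rangeH : range (pi1_map R (pH_base H)) = [set` H].

(* Closing up [c] with the reverse of a standard lift gives a loop in [Xtilde H],
   whose image lies in [H]. *)
Lemma range_path_end (c : I -> Xtilde H) u :
  is_path c (Xtilde_base H) u -> path_class H (pH H \o c) = u.
Proof.
move=> pc; have [a pa uE] := path_class_surj u.
have ps := is_path_standard_lift H pa; rewrite -uE in ps.
have pHc := is_path_pH pc.
rewrite [RHS]uE; apply/esym/(path_classP H pa pHc).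
have [l lE] := is_pathP (is_path_concat pa (is_path_reverse pHc)).
exists l; split=> //; change ([set` H] (\pi_(pi1 R x0) l)); rewrite -rangeH.
apply/range_pi1_mapP; exists (concat (standard_lift H a) (reverse c)).
  exact: is_path_concat ps (is_path_reverse pc).
rewrite comp_concat comp_reverse (pH_standard_lift H pa) -lE.
exact: homot_refl (is_path_path l).
Qed.

Lemma range_upl : unique_path_lifting R (pH H).
Proof.
move=> a b ab ab0; apply/continuousEP => t.
have [d pd dE] := path_class_surj (a zero).
have ps := is_path_standard_lift H pd; rewrite -dE in ps.
have end_at (c : continuousType I (Xtilde H)) : c zero = a zero ->
    path_class H (concat d (initial_arc (pH H \o c) t)) = c t.
  move=> c0; rewrite -[d](pH_standard_lift H pd).
  rewrite -[initial_arc (pH H \o c) t]/(pH H \o initial_arc c t) -comp_concat.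
  apply: range_path_end; apply: is_path_concat ps _; rewrite -c0.
  by apply: (@is_path_initial_arc _ _ _ _ (c one)); split => //; exact: cts_fun.
by rewrite -(end_at a) // -(end_at b) // ab.
Qed.

Lemma range_Fan_covering : Fan_covering R (pH H).
Proof.
apply: Fan_covering_intro; [exact: in_Fan_Xtilde|exact: range_upl|].
move=> Y f e y cf fy FY lift_loops.
have [d pd eE] := path_class_surj e; rewrite -fy in pd.
have ps := is_path_standard_lift H pd; rewrite -eE in ps.
have cpH : continuous (pH H) by exact: cts_fun.
have indep (n m : I -> Y) z : is_path n y z -> is_path m y z ->
    path_class H (concat d (f \o n)) = path_class H (concat d (f \o m)).
  move=> pn pm; have pfn := is_path_comp cf pn; have pfm := is_path_comp cf pm.
  have prm := is_path_reverse pfm.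
  have [b pb bh] := lift_loops _ (is_path_concat pn (is_path_reverse pm)).
  have pHb : is_path (pH H \o b) (f y) (f y) by rewrite fy; exact: is_path_comp.
  have loopE : path_class H (concat (concat d (f \o n)) (reverse (f \o m))) =
      path_class H d.
    rewrite -(path_class_concatA H pd pfn prm) -eE.
    rewrite -(range_path_end (is_path_concat ps pb)) comp_concat (pH_standard_lift H pd).
    rewrite comp_concat in bh.
    apply/esym; apply: (path_class_homot H _ _ (homot_concat _ _ _ _ _ bh)).
    - exact: is_path_concat pd pHb.
    - exact: is_path_concat pd (is_path_concat pfn prm).
    - exact: pd.
    - exact: pd.
    - exact: pHb.
    - exact: is_path_concat pfn prm.
    - exact: homot_refl pd.
  have pdn := is_path_concat pd pfn.
  rewrite -(path_class_concatr (is_path_concat pdn prm) pd pfm loopE).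
  rewrite -(path_class_concatA H pdn prm pfm) -{2}(reverseK (f \o m)).
  by rewrite (path_class_concat_reverse H pdn prm).
have [/path_connectedP pY _] := FY.
have [n pn] := choice (pY y).
exists (fun z => path_class H (concat d (f \o n z))); split.
- apply: (in_Fan_continuous FY) => Z r v cr r0.
  have pr z : is_path (fun s => r (z, s)) v (r (z, one)).
    by split => //; apply: cont_comp cr; apply: cont_pair; [exact: cst_continuous|exact: cont_id].
  pose g := concat d (f \o n v).
  have pg : is_path g x0 (f v) by apply: is_path_concat pd _; exact: is_path_comp.
  pose F (w : Z * I) := concat g (fun u => f (r (w.1, u))) w.2.
  have F0 z : F (z, zero) = x0.
    by have [_] := is_path_concat pg (is_path_comp cf (pr z)).
  have cF : continuous F.
    apply: (continuous_paste (u := fun w : Z * I => ival w.2)).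
    - apply: cont_ival; exact: cont_snd.
    - have [cg _ _] := pg; apply: cont_comp cg; apply: cont_clamp; apply: contM.
        exact: contC.
      apply: cont_ival; exact: cont_snd.
    - apply: cont_comp cf; apply: cont_comp cr; apply: cont_pair; first exact: cont_fst.
      apply: cont_clamp; apply: contB; last exact: contC.
      by apply: contM; [exact: contC|by apply: cont_ival; exact: cont_snd].
    - move=> w ->; rewrite mulfV ?pnatr_eq0 // subrr.
      have [_ _ g1] := pg; rewrite -[clamp 1]/(one : I) -[clamp 0]/(zero : I) g1.
      by rewrite r0.
  have -> : (fun z => path_class H (concat d (f \o n (r (z, one))))) =
      (fun z => path_class H (fun s => F (z, s))).
    apply/funext => z.
    rewrite (indep _ (concat (n v) (fun s => r (z, s))) (r (z, one))) //.
      rewrite comp_concat.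
      by rewrite (path_class_concatA H pd (is_path_comp cf (pn v)) (is_path_comp cf (pr z))).
    exact: is_path_concat (pn v) (pr z).
  exact: (path_class_continuous cF F0).
- rewrite (indep _ (cst y) y) //; last exact: is_path_cst.
  by rewrite (path_class_concat_cst H pd) -eE.
- by apply/funext => z /=; apply: pH_path_class; apply: is_path_concat pd _; exact: is_path_comp.
Qed.

End RangeEq.
End SubgroupPaths.

Section CoveringSubgroup.
Context {R : realType} {E X : topologicalType} (p : continuousType E X).
Hypothesis covp : Fan_covering R p.
Context {x0 : X} (H : groupClosed (pi1 R x0)) (e : E) (pe : p e = x0).
Hypothesis rangeH : range (pi1_map R pe) = [set` H].
Local Notation I := (unit_itv R).
Local Notation PS := (@path_space R X x0).
Variable L : PS -> I -> E.
Hypothesis L_continuous : forall a, continuous (L a).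
Hypothesis L_zero : forall a, L a zero = e.
Hypothesis L_lift : forall a, p \o L a = path_fun a.

Lemma covering_lift_eq (a : PS) (l : I -> E) :
  continuous l -> l zero = e -> p \o l = path_fun a -> l = L a.
Proof.
by move=> cl l0 lE; apply: (Fan_covering_eq_lift covp); rewrite ?L_lift ?L_zero.
Qed.

(* The lift of a net of paths is read off the lift of the arc-fan it spans. *)
Lemma covering_end_continuous : continuous (fun a => L a one).
Proof.
move=> a W La; apply: nbhd_net_nbhs => S.
have [G [cG GE]] := path_fan (nbhd_net_continuous (a := a) (S := S)).
have [|||||g [cg g0 gG _]] := @Fan_covering_lift_contraction _ _ _ _ covp
    (arc_fan R (nbhd_index a)) (fun z => path_fun (G z) one) e fan_vertex
    (fun z => path_fun (G z.1) z.2).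
- exact: in_Fan_arc_fan.
- apply: (cont_comp _ path_fun_continuous (f := fun z => (G z.1, z.2))).
  apply: cont_pair; last exact: cont_snd.
  by apply: cont_comp cG; exact: cont_fst.
- by [].
- by move=> z; rewrite pe (path_funP (G z)).2.
- move=> t; rewrite /fan_vertex GE path_fun_initial_arc initial_arc_at0.
  by rewrite (path_funP _).2 pe.
have gL k : g (fan_point (k, one)) = L (nbhd_net S k) one.
  rewrite -(@covering_lift_eq (nbhd_net S k) (fun t => g (fan_point (k, t)))) //.
  - apply: cont_comp cg; apply: cont_comp (@fan_point_continuous _ _ _).
    by apply: cont_pair; [exact: cst_continuous|exact: cont_id].
  - by rewrite -g0; congr g; exact: fan_point_vertex.
  - apply/funext => t; rewrite -[LHS]/((p \o g) (fan_point (k, t))) gG /=.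
    by rewrite GE path_fun_initial_arc initial_arc_one.
have cgk : continuous (fun k : adjoin_infty (nbhd_index a) => g (fan_point (k, one))).
  apply: cont_comp cg; apply: cont_comp (@fan_point_continuous _ _ _).
  by apply: cont_pair; [exact: cont_id|exact: cst_continuous].
rewrite (_ : _ @^-1` _ = (fun k => g (fan_point (k, one))) @^-1` W).
  by apply: cgk; rewrite gL.
by apply/funext => k /=; rewrite gL.
Qed.

Lemma covering_end_eq (a b : PS) :
  \pi_(Xtilde H) a = \pi_(Xtilde H) b <-> L a one = L b one.
Proof.
have pf (c : PS) : is_path (path_fun c) x0 (path_fun c one).
  by have [cc c0] := path_funP c.
have pL (c : PS) : is_path (L c) e (L c one) by split.
have pLone (c : PS) : p (L c one) = path_fun c one by rewrite -L_lift.
rewrite -{1}(to_pathK a) -{1}(to_pathK b).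
rewrite -/(path_class H (path_fun a)) -/(path_class H (path_fun b)).
split=> [ab|Lab].
  have ab1 : path_fun b one = path_fun a one.
    by rewrite -(pH_path_class H (pf b)) -ab (pH_path_class H (pf a)).
  have pb := pf b; rewrite ab1 in pb.
  have [l [lE]] := (path_classP H (pf a) pb).1 ab.
  move=> lH; have {lH} : [set` H] (\pi_(pi1 R x0) l) by [].
  rewrite -rangeH => /range_pi1_mapP[m [cm m0 m1]]; rewrite lE => -[h [ch h0 h1 he]].
  have h00 : h (zero, zero) = p e by rewrite h0 /= m0.
  have [g [cg g00 gh]] := Fan_covering_homotopy_lift covp ch h00.
  have cg1 t : continuous (fun s => g (s, t)).
    by apply: cont_comp cg; apply: cont_pair; [exact: cont_id|exact: cst_continuous].
  have cg2 s : continuous (fun t => g (s, t)).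
    by apply: cont_comp cg; apply: cont_pair; [exact: cst_continuous|exact: cont_id].
  have gE s t : p (g (s, t)) = h (s, t) by rewrite -gh.
  have gm : (fun s => g (s, zero)) = m.
    apply: (Fan_covering_eq_lift covp) => //; last by rewrite g00 m0.
    by apply/funext => s /=; rewrite gE h0.
  have g_left : (fun t => g (zero, t)) = cst e.
    apply: (Fan_covering_eq_lift covp) => //; first exact: cst_continuous.
    by apply/funext => t /=; rewrite gE (he t).1 /= m0.
  have g_right : (fun t => g (one, t)) = cst e.
    apply: (Fan_covering_eq_lift covp) => //; first exact: cst_continuous.
      by apply/funext => t /=; rewrite gE (he t).2 /= m1.
    by rewrite -[LHS]/((fun s => g (s, zero)) one) gm m1.
  pose M s := g (s, one).
  have M0 : M zero = e by rewrite /M -[LHS]/((fun t => g (zero, t)) one) g_left.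
  have M1 : M one = e by rewrite /M -[LHS]/((fun t => g (one, t)) one) g_right.
  have ML s : p (M s) = concat (path_fun a) (reverse (path_fun b)) s.
    by rewrite /M gE h1.
  rewrite -(@covering_lift_eq a (fun t => M (clamp (ival t / 2)))).
  - rewrite -(@covering_lift_eq b (reverse (fun t => M (clamp ((ival t + 1) / 2))))).
    + by rewrite /reverse ival1 subrr clampK ?lexx ?ler01 // add0r mul1r.
    + apply: (cont_comp (g := M) (f := fun t : I =>
        clamp ((ival (clamp (1 - ival t)) + 1) / 2))); last exact: cg1.
      by cont.
    + rewrite /reverse ival0 subr0 clampK ?lexx ?ler01 //.
      by rewrite (_ : (1 + 1) / 2 = 1 :> R) //; lra.
    + rewrite -[RHS]reverseK; apply/funext => t; rewrite /reverse /=.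
      rewrite ML concat_right //.
      by rewrite -ab1 /reverse ival0 subr0.
  - apply: (cont_comp (f := fun t : I => clamp (ival t / 2)) (g := M)); last exact: cg1.
    by cont.
  - by rewrite ival0 mul0r.
  - by apply/funext => t; rewrite /= ML concat_left.
have pb := pf b; rewrite -pLone -Lab pLone in pb.
apply/(path_classP H (pf a) pb).
have [l lE] := is_pathP (is_path_concat (pf a) (is_path_reverse pb)).
exists l; split=> //; change ([set` H] (\pi_(pi1 R x0) l)); rewrite -rangeH.
apply/range_pi1_mapP; exists (concat (L a) (reverse (L b))).
  by apply: is_path_concat (pL a) _; rewrite Lab; exact: is_path_reverse.
rewrite comp_concat comp_reverse !L_lift -lE.
exact: homot_refl (is_path_path l).
Qed.

Lemma covering_end_upl : unique_path_lifting R (pH H).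
Proof.
pose phi (u : Xtilde H) := L (repr u) one.
have phiE a : phi (\pi_(Xtilde H) a) = L a one.
  by apply/covering_end_eq; rewrite reprK.
have cphi : continuous phi.
  apply/(@quotient_continuous _ {eq_quot path_equiv H}).
  rewrite (_ : _ \o _ = fun a => L a one); first exact: covering_end_continuous.
  by apply/funext => a; exact: phiE.
have phi_inj u v : phi u = phi v -> u = v by move=> /covering_end_eq; rewrite !reprK.
have pphi u : p (phi u) = pH H u.
  by rewrite /phi -[LHS]/((p \o L (repr u)) one) L_lift.
move=> a b ab ab0; apply/continuousEP => t; apply: phi_inj.
have : phi \o a = phi \o b.
  apply: (Fan_covering_eq_lift covp).
  - by apply: cont_comp cphi; exact: cts_fun.
  - by apply: cont_comp cphi; exact: cts_fun.
  - apply/funext => s /=; rewrite !pphi.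
    exact: (congr1 (fun h : I -> X => h s) ab).
  - by rewrite /= ab0.
by move=> /funeqP/(_ t).
Qed.

End CoveringSubgroup.

Lemma Fan_covering_subgroup_upl (R : realType) (X : topologicalType) (x0 : X)
    (H : groupClosed (pi1 R x0)) :
  Fan_covering_subgroup H -> unique_path_lifting R (pH H).
Proof.
move=> [E [p [e [pe [covp rangeH]]]]].
have lift (a : @path_space R X x0) : exists l : unit_itv R -> E,
    [/\ continuous l, l zero = e & p \o l = path_fun a].
  have [ca a0] := path_funP a; have {}a0 := etrans a0 (esym pe).
  by have [l [cl l0 lE _]] := Fan_covering_path_lift covp ca a0; exists l.
have [L LE] := choice lift.
by apply: (@covering_end_upl R E X p covp x0 H e pe rangeH L) => a; have [] := LE a.
Qed.

Theorem theorem72 (R : realType) (X : topologicalType) (x0 : X)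
    (X_pc : path_connected R X) (H : groupClosed (pi1 R x0)) :
  [<-> Fan_covering_subgroup H;
       Fan_covering R (pH H);
       unique_path_lifting R (pH H);
       range (pi1_map R (pH_base H)) = [set` H]].
Proof.
tfae.
- by move=> /Fan_covering_subgroup_upl/upl_range/range_Fan_covering.
- exact: Fan_covering_upl.
- exact: upl_range.
- move=> rangeH; exists (Xtilde H), (pH H), (Xtilde_base H), (pH_base H).
  by split=> //; exact: range_Fan_covering.
Qed.
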